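(* Let $(S^1)^n\subset(\mathbb C^* )^n$ be the standard torus and let $\omega_{\mathrm{std}}$ be the standard symplectic structure on $(\mathbb C^* )^n$. Then for every $\phi\in\mathrm{Ham}_c((\mathbb C^* )^n,\omega_{\mathrm{std}})$ the torus $(S^1)^n$ has a self-intersection point, i.e. $\phi((S^1)^n)\cap(S^1)^n\neq\emptyset$.
   Context: $(\mathbb C^* )^n$ is identified with $(S^1)^n\times(-1,\infty)^n$, with angular coordinates $\theta_i\in S^1$ and coordinates $p_i\in(-1,\infty)$, such that $(S^1)^n=\{p_1=\cdots=p_n=0\}$; in these coordinates $\omega_{\mathrm{std}}=\sum_{i=1}^ndp_i\wedge d\theta_i$. $\mathrm{Ham}_c(M,\omega)$ is the group of time-one maps $\phi_F$ of Hamiltonian vector fields $X_F$ ($i_{X_F}\omega=dF$) of compactly supported $F\in C_c^\infty(S^1\times M)$. *)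

(* Defs.v *)
From HB Require Import structures.
From mathcomp Require Import all_boot all_order all_algebra.
From mathcomp Require Import all_classical all_reals all_analysis.

Set Implicit Arguments.
Unset Strict Implicit.
Unset Printing Implicit Defensive.

Import Order.TTheory GRing.Theory Num.Theory.
Import numFieldNormedType.Exports.

Local Open Scope classical_set_scope.
Local Open Scope ring_scope.

Definition circle (R : realType) : set (R * R) :=
  [set z | z.1 ^+ 2 + z.2 ^+ 2 = 1].

Definition ray (R : realType) : set R := [set r | -1 < r].

(* [S1] and [Ray] carry the subspace topology, and [M] the product topology,
   a row vector of elements of [T] being a point of [T ^ n]. *)
Definition S1 (R : realType) := set_type (@circle R).

Definition Ray (R : realType) := set_type (@ray R).

Definition M (R : realType) (n : nat) := ('rV[S1 R]_n * 'rV[Ray R]_n)%type.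

Lemma circle_cos_sin (R : realType) (a : R) : (cos a, sin a) \in @circle R.
Proof. by rewrite inE /circle /= cos2Dsin2. Qed.

Definition angle (R : realType) (a : R) : S1 R :=
  exist _ (cos a, sin a) (circle_cos_sin a).

Lemma ray0 (R : realType) : (0 : R) \in @ray R.
Proof. by rewrite inE /ray /= oppr_lt0 ltr01. Qed.

(* Only meant for [-1 < r]; the value at other [r] is junk. *)
Definition to_ray (R : realType) (r : R) : Ray R :=
  insubd (exist _ 0 (ray0 R) : Ray R) r.

(* The coordinates (theta, p), with theta lifted to the universal cover. Since
   the coframe (d theta, d p) is global, [coords] is also the type of all the
   tangent spaces of [M]. *)
Definition coords (R : realType) (n : nat) := ('rV[R]_n * 'rV[R]_n)%type.

Definition coords_dom (R : realType) (n : nat) : set (coords R n) :=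
  [set x : coords R n | forall i, -1 < x.2 0 i].

(* On [coords_dom], the universal covering of [M]; a local diffeomorphism. *)
Definition cover (R : realType) (n : nat) (x : coords R n) : M R n :=
  (\row_i angle (x.1 0 i), \row_i to_ray (x.2 0 i)).

(* Time lives in R / Z, modelled on the circle. *)
Definition time (R : realType) (t : R) : S1 R := angle (2 * pi * t).

(* For [U] open: [f] is of class C^k on [U]. What [f] does outside [U] is
   irrelevant, as differentials at a point only depend on the germ there. *)
Fixpoint Ck_on (R : realType) (V : normedModType R) (U : set V) (k : nat)
    (f : V -> R) : Prop :=
  if k is k'.+1 then
    (forall x, U x -> differentiable f x) /\
    (forall v, Ck_on U k' (fun x => 'D_v f x))
  else forall x, U x -> {for x, continuous f}.

Definition smooth_on (R : realType) (V : normedModType R) (U : set V)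
    (f : V -> R) : Prop := forall k, Ck_on U k f.

Definition smooth (R : realType) (n : nat) (F : S1 R * M R n -> R) : Prop :=
  smooth_on [set x : R * coords R n | coords_dom x.2]
    (fun x => F (time x.1, cover x.2)).

Definition compactly_supported (R : realType) (n : nat)
    (F : S1 R * M R n -> R) : Prop :=
  compact (closure [set x | F x != 0]).

(* \sum_i d p_i /\ d theta_i *)
Definition omega_std (R : realType) (n : nat) (u v : coords R n) : R :=
  \sum_(i < n) (u.2 0 i * v.1 0 i - u.1 0 i * v.2 0 i).

(* i_X omega = dF at each time *)
Definition is_hamiltonian_field (R : realType) (n : nat)
    (F : S1 R * M R n -> R) (X : S1 R -> M R n -> coords R n) : Prop :=
  forall (s : S1 R) (x v : coords R n), coords_dom x ->
    omega_std (X s (cover x)) v = 'd (fun y => F (s, cover y)) x v.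

(* A differentiable curve in [M] is one that has a differentiable lift. *)
Definition is_integral_curve (R : realType) (n : nat)
    (X : S1 R -> M R n -> coords R n) (g : R -> M R n) : Prop :=
  exists c : R -> coords R n, forall t : R,
    [/\ coords_dom (c t), g t = cover (c t)
      & is_derive t 1 c (X (time t) (g t))].

Definition is_flow (R : realType) (n : nat) (X : S1 R -> M R n -> coords R n)
    (Phi : R -> M R n -> M R n) : Prop :=
  forall x, Phi 0 x = x /\ is_integral_curve X (fun t => Phi t x).

Definition Ham_c (R : realType) (n : nat) : set (M R n -> M R n) :=
  [set phi | exists (F : S1 R * M R n -> R) (X : S1 R -> M R n -> coords R n)
                    (Phi : R -> M R n -> M R n),
     [/\ smooth F, compactly_supported F, is_hamiltonian_field F X,
         is_flow X Phi & phi = Phi 1]].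

Definition torus (R : realType) (n : nat) : set (M R n) :=
  [set x : M R n | forall i, \val (x.2 0 i) = 0].

Arguments Ham_c : clear implicits.
Arguments torus : clear implicits.

(* Main.v *)
From mathcomp Require Import all_boot all_order all_algebra ring lra.
From mathcomp Require Import all_classical all_reals all_analysis.
Require Import Defs.

Set Implicit Arguments.
Unset Strict Implicit.
Unset Printing Implicit Defensive.

Import Order.TTheory GRing.Theory Num.Theory.
Import numFieldNormedType.Exports.

Local Open Scope ring_scope.

(** A point of the torus returning to the torus is a solution of Hamilton's
    equations with p(0) = p(1) = 0. We discretize this boundary value problem by
    the symplectic Euler scheme with N steps: its solutions are the critical
    points of
      A(q_0, u, p) = \sum_j p_{j+1} u_j - (1 / N) \sum_k H(t_k, q_k, p_{k+1}),
    where q_k = q_0 + u_0 + ... + u_{k-1} and p_N = 0. Since H is periodic in q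
    and compactly supported, A is a bounded perturbation, with bounded and
    Lipschitz gradient, of a quadratic form of signature (m, m) on (u, p).
    Gradient descent expands the negative directions up to a bounded error, so
    the Poincare-Miranda theorem gives a starting point in the negative space
    whose negative coordinates become small after K steps. Along this descent A
    stays within bounds independent of K, hence the gradient is small at some
    step: approximate critical points suffice, and no compactness of the
    descent is needed. The resulting approximate Euler trajectories from the
    torus to itself converge, after translation by periods, to a true one as
    N tends to infinity. *)

(** * The Poincare-Miranda theorem, mod 2 on a grid *)

Section DiscreteMiranda.
Variable I : finType.
Local Notation point := {ffun I -> nat}.
Implicit Types (v w a b : point) (S : {set I}) (s : seq I).

Definition up v i : point := [ffun j => (v j + (j == i))%N].
Definition upd v i k : point := [ffun j => if j == i then k else v j].

(** A pair [v], [S] stands for the cube with lowest vertex [v] and edge directions [S], and a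
    function of it is a cubical cochain. This is the cup product of the coboundaries of the
    0-cochains [f k], in the order of [s]. Working mod 2 removes all orientation signs. *)
Fixpoint cup (f : I -> point -> 'F_2) s v S : 'F_2 :=
  if s is k :: s' then
    \sum_(i in S) (f k (up v i) - f k v) * cup f s' (up v i) (S :\ i)
  else (S == finset.set0)%:R.

Definition cobound (eta : point -> {set I} -> 'F_2) v S : 'F_2 :=
  \sum_(i in S) (eta (up v i) (S :\ i) - eta v (S :\ i)).

Fixpoint boxsum (N : nat) s (F : point -> 'F_2) w : 'F_2 :=
  if s is i :: s' then \sum_(k < N) boxsum N s' F (upd w i k) else F w.

Lemma upC v i j : up (up v i) j = up (up v j) i.
Proof. by apply/ffunP => k; rewrite !ffunE addnAC. Qed.

Lemma updC v i j k l : i != j -> upd (upd v i k) j l = upd (upd v j l) i k.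
Proof.
move=> ij; apply/ffunP => x; rewrite !ffunE.
by case: (eqVneq x j) => [->|//]; rewrite eq_sym (negbTE ij).
Qed.

Lemma up_upd v i k : up (upd v i k) i = upd v i k.+1.
Proof.
by apply/ffunP => j; rewrite !ffunE; case: eqP; rewrite ?addn1 ?addn0.
Qed.

(** Exchanging the two indices pairs off equal terms, which cancel in characteristic 2. *)
Lemma sum_sym_F2 S (c : I -> I -> 'F_2) : (forall i j, c i j = c j i) ->
  \sum_(i in S) \sum_(j in S :\ i) c i j = 0.
Proof.
move=> csym; rewrite pair_big_dep /=.
pose lt (p : I * I) := (enum_rank p.1 < enum_rank p.2)%N.
rewrite (bigID lt) /=.
rewrite [X in _ + X](reindex_inj (h := fun p : I * I => (p.2, p.1))) /=;
  last by move=> [? ?] [? ?] [-> ->].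
rewrite [X in _ + X](eq_big
  (fun p : I * I => ((p.1 \in S) && (p.2 \in S :\ p.1)) && lt p)
  (fun p => c p.1 p.2)) /=.
- have F2D (x : 'F_2) : x + x = 0.
    by rewrite -mulr2n; apply/val_inj; case: x => [[|[|]]].
  exact: F2D.
- move=> [i j] /=; rewrite !in_setD1 /lt /=.
  case: (ltngtP (enum_rank j) (enum_rank i)) => [_|ij|/val_inj/enum_rank_inj ->].
  + by rewrite !andbF.
  + have ji : i != j by apply: contraTneq ij => ->; rewrite ltnn.
    by rewrite !andbT ji eq_sym ji /= andbC.
  + by rewrite eqxx /= !andbF.
- by move=> [i j] /= _; exact: csym.
Qed.

Lemma cobound_cobound eta v S : cobound (cobound eta) v S = 0.
Proof.
rewrite /cobound.
under eq_bigr => i _ do rewrite -sumrB.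
apply: sum_sym_F2 => i j.
have -> : S :\ j :\ i = S :\ i :\ j.
  by apply/setP => k; rewrite !inE; exact: andbCA.
rewrite (upC v i j) !opprB !addrA [LHS]addrAC [RHS]addrAC; congr (_ + _).
exact: addrAC.
Qed.

(** The Leibniz rule: the coboundary of [f k] times a cochain c is d(f k) cup c plus [f k] times dc,
    and here dc = 0. Hence the cup product is exact, which is what lets Stokes' theorem apply to
    it. *)
Lemma cup_cons f k s v S : cobound (cup f s) v S = 0 ->
  cup f (k :: s) v S = cobound (fun v S => f k v * cup f s v S) v S.
Proof.
move=> d0.
transitivity (cup f (k :: s) v S + f k v * cobound (cup f s) v S).
  by rewrite d0 mulr0 addr0.
rewrite /= /cobound mulr_sumr -big_split; apply: eq_bigr => i _ /=.
by rewrite mulrBl mulrBr addrA subrK.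
Qed.

Lemma cobound_cup f s v S : cobound (cup f s) v S = 0.
Proof.
elim: s v S => [|k s IH] v S.
  by apply: big1 => i _ /=; rewrite subrr.
rewrite -[RHS](cobound_cobound (fun v S => f k v * cup f s v S) v S).
by apply: eq_bigr => i _; rewrite !cup_cons.
Qed.

(** A cube without the direction [j] lies in a hyperplane on which [f j] is constant, so the factor
    d(f j) of the product vanishes. *)
Lemma cup_eq0 (f : I -> point -> 'F_2) s v S j : j \notin S -> j \in s ->
  (forall a b, a j = v j -> b j = v j -> f j a = f j b) ->
  cup f s v S = 0.
Proof.
move=> jS js gc.
elim: s v S jS gc js => [//|k s IH] v S jS gc /=; rewrite in_cons => js.
apply: big1 => i iS.
have ij : (j == i) = false by apply: contraNF jS => /eqP ->.
have vj : up v i j = v j by rewrite ffunE ij addn0.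
case/orP: js => [/eqP <-|js]; first by rewrite (gc _ v vj) // subrr mul0r.
rewrite IH ?mulr0 //; first by rewrite in_setD1 ij.
by move=> a b; rewrite vj; exact: gc.
Qed.

(** A nonzero term of the expanded product is an edge path in the cube with one edge for each [k] in
    [s], along which [f k] changes. *)
Lemma cup_neq0 (f : I -> point -> 'F_2) s v S : cup f s v S != 0 ->
  forall k, k \in s ->
  exists a b, [/\ f k a != f k b,
    forall i, (v i <= a i <= v i + (i \in S))%N &
    forall i, (v i <= b i <= v i + (i \in S))%N].
Proof.
elim: s v S => [|l s IH] v S /=; first by [].
move=> nz k; rewrite in_cons => ks.
have [i iS] : exists2 i, i \in S &
    (f l (up v i) - f l v) * cup f s (up v i) (S :\ i) != 0.
  apply/exists_inP; apply: contraNT nz => /exists_inPn H.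
  by apply/eqP; apply: big1 => i iS; apply/eqP; have := H i iS; rewrite negbK.
rewrite mulf_eq0 negb_or subr_eq0 => /andP[gi ci].
case/orP: ks => [/eqP ->|ks].
  exists (up v i), v; split=> // j; rewrite ?ffunE ?leqnn ?leq_addr //=.
  by rewrite leq_add2l; case: eqP => // ->; rewrite iS.
have [a [b [fab Ha Hb]]] := IH _ _ ci _ ks.
exists a, b; split=> // j; [move: (Ha j)|move: (Hb j)];
  rewrite ffunE in_setD1 -addnA => /andP[H1 H2];
  rewrite (leq_trans (leq_addr _ _) H1) (leq_trans H2) // leq_add2l;
  by case: eqP => // ->; rewrite iS.
Qed.

Lemma boxsum_eq N s F G w : F =1 G -> boxsum N s F w = boxsum N s G w.
Proof.
move=> FG; elim: s w => [|i s IH] w /=; first exact: FG.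
by apply: eq_bigr => k _.
Qed.

Lemma boxsum_sum N s (P : pred I) (F : I -> point -> 'F_2) w :
  boxsum N s (fun v => \sum_(j | P j) F j v) w =
  \sum_(j | P j) boxsum N s (F j) w.
Proof.
elim: s w => [//|i s IH] w /=.
by rewrite exchange_big; apply: eq_bigr => k _.
Qed.

Lemma boxsum_ord_sum N s M (F : 'I_M -> point -> 'F_2) w :
  boxsum N s (fun v => \sum_(j < M) F j v) w = \sum_(j < M) boxsum N s (F j) w.
Proof.
elim: s w => [//|i s IH] w /=.
by rewrite exchange_big; apply: eq_bigr => k _.
Qed.

Lemma boxsum0 N s F w : (forall v, F v = 0) -> boxsum N s F w = 0.
Proof.
move=> F0; elim: s w => [|i s IH] w /=; first exact: F0.
by apply: big1 => k _.
Qed.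

Lemma boxsum_upd N s F w i k : i \notin s ->
  boxsum N s F (upd w i k) = boxsum N s (fun v => F (upd v i k)) w.
Proof.
elim: s w => [//|j s IH] w /=; rewrite in_cons negb_or => /andP[ij is_].
by apply: eq_bigr => l _; rewrite updC // IH.
Qed.

Lemma boxsum_telescope N s i (h : point -> 'F_2) w : i \notin s ->
  boxsum N (i :: s) (fun v => h (up v i) - h v) w =
  boxsum N s (fun v => h (upd v i N) - h (upd v i 0)) w.
Proof.
move=> is_ /=.
under eq_bigr => k _ do rewrite boxsum_upd //.
rewrite -boxsum_ord_sum; apply: boxsum_eq => v.
under eq_bigr => k _ do rewrite up_upd.
rewrite -(big_mkord xpredT (fun k => h (upd v i k.+1) - h (upd v i k))).
by rewrite telescope_sumr.
Qed.

Lemma boxsum_diff0 N s i (h : point -> 'F_2) w : uniq s -> i \in s ->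
  (forall v, h (upd v i N) = 0) -> (forall v, h (upd v i 0) = 0) ->
  boxsum N s (fun v => h (up v i) - h v) w = 0.
Proof.
move=> us is_ hN h0; elim: s us is_ w => [//|j s IH] /andP[js us].
rewrite in_cons; case: (eqVneq i j) => [e _ w|ij /= is_ w]; last first.
  by apply: big1 => k _; apply: IH.
rewrite -e in js *; rewrite boxsum_telescope //.
by apply: boxsum0 => v; rewrite hN h0 subrr.
Qed.

(** Induction by Stokes' theorem. The product is the coboundary of [f i] times the product over the
    tail, so its sum reduces to faces of the box. In the direction [i] only the face v_i = N
    survives, where [f i] is 1, and it carries the sum of smaller dimension. In a direction [j] of
    the tail, [f j] is constant on both faces, so the product over the tail vanishes there by
    [cup_eq0]. *)
Lemma boxsum_cup N s (f : I -> point -> 'F_2) w : uniq s ->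
  (forall i v, i \in s -> v i = 0%N -> f i v = 0) ->
  (forall i v, i \in s -> v i = N -> f i v = 1) ->
  boxsum N s (fun v => cup f s v [set:: s]) w = 1.
Proof.
elim: s w => [|i s IH] w us f0 fN.
  by rewrite /= finset.set_nil eqxx.
move: (us) => /= /andP[is_ us'].
rewrite -/(boxsum N (i :: s) _ w).
rewrite (boxsum_eq _ _ _ (G := fun v => \sum_(j in [set:: i :: s])
  (f i (up v j) * cup f s (up v j) ([set:: i :: s] :\ j) -
   f i v * cup f s v ([set:: i :: s] :\ j)))); last first.
  by move=> v; apply: cup_cons; exact: cobound_cup.
rewrite boxsum_sum (bigD1 i) ?inE ?eqxx //= [X in _ + X]big1 ?addr0 => [|j].
  rewrite -/(boxsum N (i :: s) _ w).
  rewrite [LHS](@boxsum_telescope N s i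
    (fun v => f i v * cup f s v ([set:: i :: s] :\ i))) //.
  rewrite -[RHS](IH (upd w i N)) // => [|k v ks|k v ks]; last first.
  - by apply: fN; rewrite in_cons ks orbT.
  - by apply: f0; rewrite in_cons ks orbT.
  rewrite boxsum_upd //; apply: boxsum_eq => v.
  rewrite fN ?in_cons ?eqxx ?ffunE ?eqxx // mul1r.
  rewrite f0 ?in_cons ?eqxx ?ffunE ?eqxx // mul0r subr0.
  congr cup; apply/setP => k; rewrite !inE.
  by case: (eqVneq k i) => // ->; rewrite (negbTE is_).
rewrite !inE => /andP[js ji]; rewrite (negbTE ji) /= in js.
have js' : j \in i :: s by rewrite in_cons js orbT.
have nj v c : (forall a, a j = upd v j c j -> f j a = f j (upd v j c)) ->
    cup f s (upd v j c) ([set:: i :: s] :\ j) = 0.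
  move=> H; apply: (@cup_eq0 f s _ _ j); [by rewrite !inE eqxx|exact: js|].
  by move=> a b /H -> /H ->.
apply: (@boxsum_diff0 N (i :: s) j
  (fun v => f i v * cup f s v ([set:: i :: s] :\ j))) => // v.
  rewrite nj ?mulr0 // => a; rewrite ffunE eqxx => aj.
  by rewrite !fN // ffunE eqxx.
rewrite nj ?mulr0 // => a; rewrite ffunE eqxx => aj.
by rewrite !f0 // ffunE eqxx.
Qed.

Lemma boxsum_neq0 N s F w : boxsum N s F w != 0 -> exists v,
  [/\ F v != 0, forall i, i \in s -> (v i < N)%N &
      forall i, i \notin s -> v i = w i].
Proof.
elim: s w => [|i s IH] w /=; first by exists w.
move=> nz.
have [k Hk] : exists k : 'I_N, boxsum N s F (upd w i k) != 0.
  apply/existsP; apply: contraNT nz => /existsPn H.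
  by apply/eqP; apply: big1 => k _; apply/eqP; have := H k; rewrite negbK.
have [v [Fv vs vns]] := IH _ Hk.
exists v; split=> // j; rewrite in_cons.
  have [jsin _|jsn] := boolP (j \in s); first exact: vs.
  by rewrite orbF => /eqP e; rewrite vns // ffunE e eqxx.
rewrite negb_or => /andP[ji js]; rewrite vns // ffunE (negbTE ji) //.
Qed.

(** The cup product of the indicators sums to 1 over the box, so it is nonzero on some cube, and on
    that cube every [f i] takes both values. *)
Theorem discrete_miranda N s (f : I -> point -> bool) : uniq s ->
  (forall i v, i \in s -> v i = 0%N -> ~~ f i v) ->
  (forall i v, i \in s -> v i = N -> f i v) ->
  exists v, [/\ forall i, i \in s -> (v i < N)%N,
    forall i, i \notin s -> v i = 0%N &
    forall i, i \in s -> exists a b, [/\ f i a, ~~ f i b,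
      forall j, (v j <= a j <= v j + (j \in s))%N &
      forall j, (v j <= b j <= v j + (j \in s))%N]].
Proof.
move=> us f0 fN.
pose g i v : 'F_2 := (f i v)%:R.
have /boxsum_neq0[v [Fv vs vns]] :
    boxsum N s (fun v => cup g s v [set:: s]) [ffun=> 0%N] != 0.
  rewrite boxsum_cup ?oner_eq0 // => i v is_ vi; rewrite /g.
    by rewrite (negbTE (f0 _ _ is_ vi)).
  by rewrite fN.
exists v; split=> // i is_; first by rewrite vns // ffunE.
have [a [b [gab Ha Hb]]] := cup_neq0 Fv is_.
have Ha' j : (v j <= a j <= v j + (j \in s))%N by have := Ha j; rewrite inE.
have Hb' j : (v j <= b j <= v j + (j \in s))%N by have := Hb j; rewrite inE.
move: gab; rewrite /g; have [fa|fa] := boolP (f i a).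
  by have [fb|fb] := boolP (f i b) => // _; exists a, b.
by have [fb|fb] := boolP (f i b) => // _; exists b, a.
Qed.

End DiscreteMiranda.

(** * Approximate critical points of perturbed quadratic forms *)

Section ApproxCritical.
Variables (R : realType) (I : finType).
Local Notation X := {ffun I -> R}.
Implicit Types x y : X.

(** Lipschitz continuity for the sup norm, expressed by a common bound [r] on the coordinates. *)
Definition sup_lipschitz (L : R) (F : X -> X) := forall (x y : X) r,
  (forall i, `|x i - y i| <= r) -> forall i, `|F x i - F y i| <= L * r.

Theorem approx_miranda (J : {set I}) (C L : R) (F : X -> X) :
  0 < C -> sup_lipschitz L F ->
  (forall i x, i \in J -> x i = C -> 0 < F x i) ->
  (forall i x, i \in J -> x i = - C -> F x i <= 0) ->
  forall e : R, 0 < e -> exists x : X, (forall i, i \notin J -> x i = 0) /\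
    forall i, i \in J -> `|F x i| <= e.
Proof.
move=> C0 Flip FC FNC e e0.
(* The grid has mesh h = 2 C / (N + 1), and this [N] gives L h <= e: inside one cell each coordinate
   of [F] stays within [e] of its value at the base vertex. A cell on which it takes both signs then
   has a base vertex where it is at most [e] in absolute value. *)
have [N HN] : exists N, 2 * C * L / e < N.+1%:R.
  exists (Num.truncn (2 * C * L / e)); rewrite truncnS_gt //.
have N0 : 0 < N.+1%:R :> R by rewrite ltr0n.
have Nn0 : N.+1%:R != 0 :> R by rewrite gt_eqF.
pose h : R := 2 * C / N.+1%:R.
have h0 : 0 < h by rewrite divr_gt0 // mulr_gt0.
pose y (v : {ffun I -> nat}) : X :=
  [ffun i => if i \in J then - C + h * (v i)%:R else 0].
have [|i v|i v|v [vN v0 Hv]] :=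
  @discrete_miranda I N.+1 (enum J) (fun i v => 0 < F (y v) i).
- by rewrite enum_uniq.
- rewrite mem_enum -leNgt => iJ vi; apply: FNC => //.
  by rewrite ffunE iJ vi mulr0 addr0.
- rewrite mem_enum => iJ vi; apply: FC => //.
  by rewrite ffunE iJ vi divfK //; ring.
exists (y v); split=> [i iJ|i iJ]; first by rewrite ffunE (negbTE iJ).
have close (a : {ffun I -> nat}) :
    (forall j, (v j <= a j <= v j + (j \in enum J))%N) ->
    `|F (y v) i - F (y a) i| <= L * h.
  move=> Ha; apply: Flip => j; rewrite !ffunE; case: ifP => jJ; last first.
    by rewrite subrr normr0 ltW.
  have := Ha j; rewrite mem_enum jJ => /andP[va av].
  rewrite opprD addrACA subrr add0r -mulrBr normrM (gtr0_norm h0).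
  rewrite ler_piMr ?(ltW h0) // distrC ger0_norm ?subr_ge0 ?ler_nat //.
  by rewrite lerBlDl natr1 ler_nat -addn1.
have Lh : L * h <= e.
  move: (ltW HN); rewrite ler_pdivrMr // => H.
  have -> : L * h = 2 * C * L / N.+1%:R by rewrite /h; ring.
  by rewrite ler_pdivrMr // [e * _]mulrC.
have [|a [b [Fa Fb Ha Hb]]] := Hv i; first by rewrite mem_enum.
have {}Fb : F (y b) i <= 0 by rewrite leNgt.
move: (close _ Ha) (close _ Hb); rewrite !ler_norml.
by move=> /andP[H1 _] /andP[_ H2]; lra.
Qed.

Variables (sigma : I -> R) (C L : R) (b : X -> R) (g : X -> X).
Hypotheses (sigma2 : forall i, `|sigma i| <= 2).
Hypothesis sigma_gap : forall i, sigma i < 0 -> sigma i <= -1.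
Hypothesis L0 : 0 <= L.
Hypothesis b_bound : forall x, `|b x| <= C.
Hypothesis g_bound : forall x i, `|g x i| <= C.
Hypothesis g_lip : sup_lipschitz L g.
Hypothesis b_taylor : forall x y,
  b y <= b x + \sum_i g x i * (y i - x i) + L * \sum_i (y i - x i) ^+ 2.

Let A x := \sum_i sigma i / 2 * x i ^+ 2 + b x.
Let grad x : X := [ffun i => sigma i * x i + g x i].
Let s : R := (2 * (1 + L))^-1.
Let step x : X := [ffun i => x i - s * grad x i].

Let s0 : 0 < s. Proof. by rewrite invr_gt0 mulr_gt0 // ltr_pwDl. Qed.

(** The first-order gain is s |grad|^2. The second-order loss is at most (1 + L) s^2 |grad|^2,
    because sigma_i / 2 <= 1, and the step size [s] makes this exactly half of the gain. *)
Lemma descent x : A (step x) <= A x - s / 2 * \sum_i grad x i ^+ 2.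
Proof.
have sE : s * (1 + L) = 1 / 2.
  rewrite /s invfM -mulrA mulVf ?mulr1 ?div1r // gt_eqF //.
  by rewrite ltr_pwDl.
have H := b_taylor x (step x).
apply: (@le_trans _ _ (\sum_i sigma i / 2 * step x i ^+ 2 +
  (b x + \sum_i g x i * (step x i - x i) + L * \sum_i (step x i - x i) ^+ 2))).
  by rewrite lerD2l.
rewrite -addrA [leLHS]addrCA [leRHS](_ : _ = b x +
  (\sum_i sigma i / 2 * x i ^+ 2 - s / 2 * \sum_i grad x i ^+ 2)); last first.
  by rewrite /A addrAC addrC.
rewrite lerD2l.
rewrite !mulr_sumr -!big_split -sumrB /=; apply: ler_sum => i _.
have -> : step x i = x i - s * grad x i by rewrite ffunE.
have gE : g x i = grad x i - sigma i * x i by rewrite !ffunE; ring.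
rewrite gE; set d := grad x i.
have H1 : (sigma i / 2) * (s * d) ^+ 2 <= 1 * (s * d) ^+ 2.
  apply: ler_wpM2r; first exact: sqr_ge0.
  by have := sigma2 i; rewrite ler_norml => /andP[_ ?]; lra.
have H2 : (1 + L) * (s * d) ^+ 2 = s / 2 * d ^+ 2.
  have -> : (1 + L) * (s * d) ^+ 2 = s * (1 + L) * (s * d ^+ 2) by ring.
  by rewrite sE; ring.
nra.
Qed.

Lemma step_lip : sup_lipschitz (1 + s * (2 + L)) step.
Proof.
move=> x y r xy i; rewrite !ffunE.
have -> : x i - s * (sigma i * x i + g x i) -
    (y i - s * (sigma i * y i + g y i)) =
    (x i - y i) - s * (sigma i * (x i - y i) + (g x i - g y i)) by ring.
rewrite (le_trans (ler_normB _ _)) // mulrDl mul1r lerD // normrM gtr0_norm //.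
rewrite -mulrA ler_pM2l // mulrDl (le_trans (ler_normD _ _)) // lerD //.
  by rewrite normrM ler_pM.
exact: g_lip.
Qed.

Lemma iter_lip k : exists L', sup_lipschitz L' (iter k step).
Proof.
elim: k => [|k [L' IH]]; first by exists 1 => x y r xy i; rewrite mul1r.
exists ((1 + s * (2 + L)) * L') => x y r xy i.
by rewrite -mulrA; apply: step_lip => j; apply: IH.
Qed.

(** With sigma_i <= -1 and x_i >= c >= C, the linear part of the gradient outweighs the
    perturbation, which is at most C; the gradient is then nonpositive and descent moves x_i
    outwards. *)
Lemma step_ge i x (c : R) : sigma i < 0 -> C <= c -> c <= x i -> c <= step x i.
Proof.
move=> /sigma_gap si Cc cx; rewrite !ffunE.
have := g_bound x i; rewrite ler_norml => /andP[_ gi].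
have C0 : 0 <= C := le_trans (normr_ge0 _) (b_bound x).
have H : sigma i * x i + g x i <= 0 by nra.
by have := s0; nra.
Qed.

Lemma step_le_opp i x (c : R) : sigma i < 0 -> C <= c -> x i <= - c ->
  step x i <= - c.
Proof.
move=> /sigma_gap si Cc cx; rewrite !ffunE.
have := g_bound x i; rewrite ler_norml => /andP[gi _].
have C0 : 0 <= C := le_trans (normr_ge0 _) (b_bound x).
have H : 0 <= sigma i * x i + g x i by nra.
by have := s0; nra.
Qed.

(* Descend from the negative space; the coordinates in the negative space are
   expanded by each step, so Miranda's theorem yields a starting point for which
   they are small after [K] steps. There the action is bounded from below. *)
Theorem approx_critical (e : R) : 0 < e ->
  exists x : X, \sum_i (sigma i * x i + g x i) ^+ 2 <= e.
Proof.
move=> e0; pose J := [set i | sigma i < 0].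
have C0 : 0 <= C := le_trans (normr_ge0 _) (b_bound 0).
(* [D] bounds the total drop of the action: it will be at most C at the start and at least - C -
   #|I| at the end. If every gradient were large, K + 1 steps would lose more than [D]. *)
pose D : R := 2 * C + #|I|%:R.
have [K HK] : exists K, D / (s / 2 * e) < K.+1%:R.
  by exists (Num.truncn (D / (s / 2 * e))); rewrite truncnS_gt.
have [L' lipK] := iter_lip K.+1.
(* On the faces x_i = C + 1 and x_i = - (C + 1) every step preserves the sign of x_i, which gives
   Miranda's boundary conditions for the iterate; the summand 1 makes the positive one strict.
   Tolerance 1 suffices for the lower bound on the final action. *)
have [|||x [x0 Hx]] := @approx_miranda J (C + 1) L' (iter K.+1 step) _ lipK
  _ _ 1 ltr01.
- by rewrite ltr_wpDl.
- move=> i y; rewrite inE => si yi.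
  apply: (@lt_le_trans _ _ (C + 1)); first by rewrite ltr_wpDl.
  by elim: K.+1 => [|k IH] /=; [rewrite yi|apply: step_ge => //; rewrite lerDl].
- move=> i y; rewrite inE => si yi.
  apply: (@le_trans _ _ (- (C + 1))); last by rewrite oppr_le0 addr_ge0.
  by elim: K.+1 => [|k IH] /=; [rewrite yi|apply: step_le_opp => //; rewrite lerDl].
have [/existsP[k Hk]|/existsPn small] := boolP [exists k : 'I_K.+1,
    \sum_i grad (iter k step x) i ^+ 2 <= e].
  exists (iter k step x); apply: le_trans Hk.
  by apply: ler_sum => i _; rewrite ffunE.
have drop k : (k <= K.+1)%N ->
    A (iter k step x) <= A x - s / 2 * e * k%:R.
  elim: k => [_|k IH kK]; first by rewrite mulr0 subr0.
  rewrite (le_trans (descent _)) // -[k.+1%:R]natr1 mulrDr mulr1 opprD addrA lerD //.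
    by apply: IH; apply: ltnW.
  rewrite lerN2 ler_pM2l ?divr_gt0 //.
  by have := small (Ordinal kK); rewrite -ltNge => /ltW.
(* The start [x] vanishes outside the negative directions, so the quadratic part is at most 0. *)
have Ax : A x <= C.
  rewrite /A -[leRHS]add0r lerD //; last first.
    by have := b_bound x; rewrite ler_norml => /andP[].
  apply: sumr_le0 => i _; have [si|si] := ltP (sigma i) 0.
    by have := sqr_ge0 (x i); nra.
  by rewrite x0 ?inE -?leNgt // expr0n mulr0.
(* After the descent each negative coordinate is at most 1 in absolute value and contributes at
   least -1, since sigma_i / 2 >= -1. *)
have AK : - C - #|I|%:R <= A (iter K.+1 step x).
  rewrite /A [leRHS]addrC lerD //.
    by have := b_bound (iter K.+1 step x); rewrite ler_norml => /andP[].
  rewrite -sum1_card natr_sum -sumrN; apply: ler_sum => i _.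
  have [si|si] := ltP (sigma i) 0; last first.
    by rewrite (le_trans (lerN10 _)) // mulr_ge0 ?sqr_ge0 // divr_ge0.
  have := Hx i; rewrite inE => /(_ si); set y := fun_of_fin _ i => yi.
  have {}yi : y ^+ 2 <= 1 by rewrite -real_normK ?num_real // expr_le1.
  have := sigma2 i; rewrite ler_norml => /andP[s2 _].
  by have := sqr_ge0 y; nra.
have se0 : 0 < s / 2 * e by rewrite !mulr_gt0 // invr_gt0.
move: HK; rewrite ltr_pdivrMr //.
have := drop K.+1 (leqnn _); rewrite /D [_ * (s / 2 * e)]mulrC; lra.
Qed.
End ApproxCritical.

(** * Critical points when the perturbation is a sum of functions of linear maps *)

Lemma sum_const (R : pzRingType) (I : finType) (c : R) :
  \sum_(i : I) c = #|I|%:R * c.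
Proof. by rewrite sumr_const mulr_natl. Qed.

Lemma sqr_sum_le (R : realDomainType) (I : finType) (e : I -> R) :
  (\sum_i e i) ^+ 2 <= #|I|%:R * \sum_i e i ^+ 2.
Proof.
have H : \sum_i \sum_j (e i - e j) ^+ 2 >= 0.
  by apply: sumr_ge0 => i _; apply: sumr_ge0 => j _; apply: sqr_ge0.
suff E : \sum_i \sum_j (e i - e j) ^+ 2 =
    2 * (#|I|%:R * \sum_i e i ^+ 2 - (\sum_i e i) ^+ 2).
  by move: H; rewrite E pmulr_rge0 // subr_ge0.
transitivity (\sum_i (#|I|%:R * e i ^+ 2 + \sum_j e j ^+ 2
    - 2 * (e i * \sum_j e j))).
  apply: eq_bigr => i _; rewrite !mulr_sumr -sum_const -big_split -sumrB /=.
  by apply: eq_bigr => j _; ring.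
rewrite sumrB big_split /= -!mulr_sumr -mulr_suml sum_const expr2; ring.
Qed.

Section Composite.
Variables (R : realType) (I K T : finType) (alpha : K -> T -> I -> R).
Local Notation X := {ffun I -> R}.
Local Notation Z := {ffun T -> R}.
Variables (phi : K -> Z -> R) (psi : K -> Z -> Z) (C L : R).

Definition ell k (x : X) : Z := [ffun t => \sum_a alpha k t a * x a].

(** The chain rule for the gradient of the sum of the [phi k (ell k x)], with [psi k] in the role of
    the gradient of [phi k]. *)
Definition composite_grad (x : X) : X :=
  [ffun a => \sum_k \sum_t alpha k t a * psi k (ell k x) t].

Hypotheses (C0 : 0 <= C) (L0 : 0 <= L).
Hypothesis alpha1 : forall k t a, `|alpha k t a| <= 1.
Hypothesis phi_bound : forall k z, `|phi k z| <= C.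
Hypothesis psi_bound : forall k z t, `|psi k z t| <= C.
Hypothesis psi_lip : forall k, sup_lipschitz L (psi k).
Hypothesis phi_taylor : forall k (z w : Z),
  phi k w <= phi k z + \sum_t psi k z t * (w t - z t)
             + L * \sum_t (w t - z t) ^+ 2.

(** The bounds on the single terms add up to bounds for the sum that grow with the cardinalities of
    [K], [T] and [I]. This is harmless: no such constant enters the conclusion, which holds for
    every [e]. *)
Theorem approx_critical_composite (sigma : I -> R) :
  (forall i, `|sigma i| <= 2) -> (forall i, sigma i < 0 -> sigma i <= -1) ->
  forall e : R, 0 < e ->
  exists x : X, forall a, `|sigma a * x a + composite_grad x a| <= e.
Proof.
move=> s2 sgap e e0.
pose b x := \sum_k phi k (ell k x).
pose k0 : R := #|K|%:R; pose t0 : R := #|T|%:R; pose i0 : R := #|I|%:R.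
have ellB k x y t : ell k y t - ell k x t = \sum_a alpha k t a * (y a - x a).
  by rewrite !ffunE -sumrB; apply: eq_bigr => a _; rewrite mulrBr.
have k00 : 0 <= k0 by []. have t00 : 0 <= t0 by []. have i00 : 0 <= i0 by [].
have sum_le (J : finType) (f : J -> R) c : (forall j, `|f j| <= c) ->
    `|\sum_j f j| <= #|J|%:R * c.
  move=> fc; rewrite -sum_const (le_trans (ler_norm_sum _ _ _)) //.
  exact: ler_sum.
have al_le k t a (c u : R) : `|u| <= c -> `|alpha k t a * u| <= c.
  move=> uc; rewrite normrM (le_trans _ uc) // ler_piMl //.
have b_bound x : `|b x| <= k0 * C + k0 * (t0 * C).
  rewrite (@le_trans _ _ (k0 * C)) ?lerDl ?mulr_ge0 //.
  exact: sum_le.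
have g_bound x a : `|composite_grad x a| <= k0 * C + k0 * (t0 * C).
  rewrite (@le_trans _ _ (k0 * (t0 * C))) ?lerDr ?mulr_ge0 //.
  rewrite ffunE; apply: (sum_le) => k; apply: (sum_le) => t; exact: al_le.
have g_lip : sup_lipschitz (k0 * (t0 * (L * i0))) composite_grad.
  move=> x y r xy a; rewrite !ffunE -sumrB -!mulrA; apply: (sum_le) => k.
  rewrite -sumrB; apply: (sum_le) => t; rewrite -mulrBr; apply: (al_le).
  apply: psi_lip => t'; rewrite ellB; apply: (sum_le) => a'; apply: (al_le).
  exact: xy.
have taylor x y : b y <= b x + \sum_a composite_grad x a * (y a - x a)
    + k0 * (t0 * (L * i0)) * \sum_a (y a - x a) ^+ 2.
  pose S := \sum_a (y a - x a) ^+ 2.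
  have -> : b x + \sum_a composite_grad x a * (y a - x a) +
      k0 * (t0 * (L * i0)) * S = \sum_k (phi k (ell k x) +
      \sum_t psi k (ell k x) t * (ell k y t - ell k x t) + t0 * (L * i0) * S).
    rewrite !big_split /= sum_const; congr (_ + _ + _); last by rewrite -/k0; ring.
    under eq_bigr => a _ do rewrite ffunE mulr_suml.
    rewrite exchange_big /=; apply: eq_bigr => k _.
    under eq_bigr => a _ do rewrite mulr_suml.
    rewrite exchange_big /=; apply: eq_bigr => t _.
    rewrite ellB mulr_sumr; apply: eq_bigr => a _.
    by rewrite -mulrA mulrCA.
  rewrite [leLHS]/b; apply: ler_sum => k _.
  rewrite (le_trans (phi_taylor k (ell k x) (ell k y))) //.
  rewrite lerD2l.
  have -> : t0 * (L * i0) * S = L * (t0 * (i0 * S)) by ring.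
  rewrite ler_wpM2l // -sum_const; apply: ler_sum => t _.
  rewrite ellB (le_trans (sqr_sum_le _)) // ler_wpM2l //.
  apply: ler_sum => a _; rewrite exprMn ler_piMl ?sqr_ge0 //.
  by rewrite -real_normK ?num_real // expr_le1.
have L'0 : 0 <= k0 * (t0 * (L * i0)) by rewrite !mulr_ge0.
have e20 : 0 < e ^+ 2 by rewrite exprn_gt0.
have [x Hx] := approx_critical s2 sgap L'0 b_bound g_bound g_lip taylor e20.
exists x => a; rewrite -ler_sqr ?nnegrE ?(ltW e0) //.
rewrite real_normK ?num_real // (le_trans _ Hx) // (bigD1 a) //= lerDl.
by apply: sumr_ge0 => i _; apply: sqr_ge0.
Qed.
End Composite.

(** * The discrete action *)

Section DiscreteChord.
Variables (R : realType) (n m : nat).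
Local Notation T := (bool * 'I_n)%type.
Local Notation I := ('I_n + bool * ('I_m * 'I_n))%type.
Local Notation Z := {ffun T -> R}.

(* The configuration (q_0, u, p) of the discrete action is given by
   p_{j+1} = x_j + y_j and u_j = q_{j+1} - q_j = x_j - y_j, so that
   \sum_j p_{j+1} u_j = \sum_j (x_j ^ 2 - y_j ^ 2). *)
Definition chord_coef (k : 'I_m.+1) (t : T) (a : I) : R :=
  match a with
  | inl i => (t.1 && (t.2 == i))%:R
  | inr (s, (j, i)) =>
      if t.1 then (-1) ^+ (~~ s) * ((j < k)%N && (t.2 == i))%:R
      else ((j == k :> nat) && (t.2 == i))%:R
  end.

(** The eigenvalues of the Hessian of \sum_j (x_j ^ 2 - y_j ^ 2): 0 on q_0, 2 on x (tag [true]) and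
    -2 on y (tag [false]). *)
Definition chord_sign (a : I) : R :=
  match a with inl _ => 0 | inr (s, _) => (-1) ^+ (~~ s) * 2 end.

Lemma sum_chord_index (F : I -> R) : \sum_a F a =
  \sum_i F (inl i) +
  \sum_j \sum_i (F (inr (true, (j, i))) + F (inr (false, (j, i)))).
Proof.
rewrite big_sumType /=; congr (_ + _).
rewrite (eq_bigr (fun p => F (inr (p.1, p.2)))) => [|[]//].
rewrite -(pair_bigA _ (fun s p => F (inr (s, p)))) /= big_bool /=.
rewrite -big_split /= pair_bigA /=.
by apply: eq_bigr => -[j i].
Qed.

Lemma sum_delta (N : nat) (i : 'I_N) (F : 'I_N -> R) :
  \sum_k (k == i)%:R * F k = F i.
Proof.
rewrite (bigD1 i) //= eqxx mul1r big1 ?addr0 // => k /negbTE ->.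
by rewrite mul0r.
Qed.

Variables (phi : 'I_m.+1 -> Z -> R) (psi : 'I_m.+1 -> Z -> Z) (C L : R).
Hypotheses (C0 : 0 <= C) (L0 : 0 <= L).
Hypothesis phi_bound : forall k z, `|phi k z| <= C.
Hypothesis psi_bound : forall k z t, `|psi k z t| <= C.
Hypothesis psi_lip : forall k, sup_lipschitz L (psi k).
Hypothesis phi_taylor : forall k (z w : Z),
  phi k w <= phi k z + \sum_t psi k z t * (w t - z t)
             + L * \sum_t (w t - z t) ^+ 2.

(** The equations of a critical point in x_j and y_j read 2 x_j + S_{j+1} + psi_j = 0 and - 2 y_j -
    S_{j+1} + psi_j = 0, with psi_j the p-component and S_{j+1} the sum of the later q-components.
    Adding them gives the Euler equation for q, subtracting them gives p_{j+1} = - S_{j+1}, and the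
    equation in q_0 is S_0 = 0. *)
Theorem discrete_chord (e : R) : 0 < e -> exists Q P : nat -> 'I_n -> R,
  [/\ forall i, P 0%N i = 0, forall i, P m.+1 i = 0 &
    forall (k : 'I_m.+1) i,
    let w : Z := [ffun t => if t.1 then Q k t.2 else P k.+1 t.2] in
    `|P k.+1 i - P k i - psi k w (true, i)| <= e /\
    `|Q k.+1 i - Q k i + psi k w (false, i)| <= e].
Proof.
move=> e0; have e20 : 0 < e / 2 by rewrite divr_gt0.
have coef1 k t a : `|chord_coef k t a| <= 1.
  have b1 (b : bool) : `|b%:R : R| <= 1 by case: b; rewrite ?normr1 ?normr0.
  case: a => [i|[s [j i]]] /=; first exact: b1.
  by case: ifP => _; rewrite ?normrM ?normr_sign ?mul1r; exact: b1.
have s2 a : `|chord_sign a| <= 2.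
  case: a => [i|[s p]] /=; first by rewrite normr0.
  by rewrite normrM normr_sign mul1r ger0_norm.
have sgap a : chord_sign a < 0 -> chord_sign a <= -1.
  case: a => [i|[[] p]] /=; rewrite ?ltxx // ?expr0 ?expr1; lra.
have [x Hx] := approx_critical_composite C0 L0 coef1 phi_bound psi_bound psi_lip
  phi_taylor s2 sgap e20.
(* The argument of the [k]-th term of the action: q_k at the indices [(true, i)], p_{k+1} at
   [(false, i)]. *)
pose q k := ell chord_coef k x.
pose X j i := x (inr (true, (j, i))); pose Y j i := x (inr (false, (j, i))).
have qT k i : q k (true, i) =
    x (inl i) + \sum_(j < m) (j < k)%:R * (X j i - Y j i).
  rewrite ffunE sum_chord_index /= -[x (inl i)](sum_delta i (fun i => x (inl i))).
  congr (_ + _); first by apply: eq_bigr => i' _; rewrite eq_sym.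
  apply: eq_bigr => j _.
  rewrite -[RHS](sum_delta i (fun i => (j < k)%:R * (X j i - Y j i))).
  apply: eq_bigr => i' _; rewrite [i == i']eq_sym /X /Y expr0 expr1 -mulnb natrM; ring.
have qF k i : q k (false, i) =
    \sum_(j < m) (j == k :> nat)%:R * (X j i + Y j i).
  rewrite ffunE sum_chord_index /= big1 ?add0r => [|i' _]; last by rewrite mul0r.
  apply: eq_bigr => j _.
  rewrite -[RHS](sum_delta i (fun i => (j == k :> nat)%:R * (X j i + Y j i))).
  apply: eq_bigr => i' _; rewrite [i == i']eq_sym /X /Y -mulnb natrM; ring.
(* Since q_l contains u_j exactly when j < l, the derivative in u_j collects the q-components from l
   = j + 1 on. *)
pose S k i := \sum_(l < m.+1) (k <= l)%:R * psi l (q l) (true, i).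
have gz i : `|S 0%N i| <= e / 2.
  have := Hx (inl i); rewrite /= mul0r add0r ffunE; congr (`|_| <= _).
  apply: eq_bigr => l _; rewrite mul1r.
  rewrite (eq_bigr (fun p => (p.1 && (p.2 == i))%:R * psi l (q l) (p.1, p.2)))
    => [|[]//].
  rewrite -(pair_bigA _ (fun b i' =>
    (b && (i' == i))%:R * psi l (q l) (b, i'))) /=.
  rewrite big_bool /= [X in _ + X]big1 ?addr0 => [|i' _]; last by rewrite mul0r.
  exact: (sum_delta i (fun i => psi l (q l) (true, i))).
have gj s (j : 'I_m) i : composite_grad chord_coef psi x (inr (s, (j, i))) =
    (-1) ^+ (~~ s) * S j.+1 i +
    psi (widen_ord (leqnSn m) j) (q (widen_ord (leqnSn m) j)) (false, i).
  rewrite ffunE /S mulr_sumr.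
  rewrite -(sum_delta (widen_ord (leqnSn m) j) (fun k => psi k (q k) (false, i))).
  rewrite -big_split; apply: eq_bigr => k _ /=.
  rewrite (eq_bigr (fun p =>
      (if p.1 then (-1) ^+ (~~ s) * ((j < k)%N && (p.2 == i))%:R
      else ((j == k :> nat) && (p.2 == i))%:R) * psi k (q k) (p.1, p.2)))
    => [|[]//].
  rewrite -(pair_bigA _ (fun b i' =>
      (if b then (-1) ^+ (~~ s) * ((j < k)%N && (i' == i))%:R
      else ((j == k :> nat) && (i' == i))%:R) * psi k (q k) (b, i'))) /=.
  rewrite big_bool /=; congr (_ + _).
    rewrite -[RHS](sum_delta i (fun i =>
      (-1) ^+ (~~ s) * ((j < k)%:R * psi k (q k) (true, i)))).
    by apply: eq_bigr => i' _; rewrite -mulnb natrM; ring.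
  rewrite -[RHS](sum_delta i (fun i => (k == widen_ord (leqnSn m) j)%:R *
      psi k (q k) (false, i))).
  apply: eq_bigr => i' _; rewrite -mulnb natrM -val_eqE /= eq_sym; ring.
(* There are m + 1 Euler steps but only m pairs x_j, y_j, so p_{m+1} comes out as 0. The value p_0 =
   0 is imposed, and S_0 being small makes it compatible with the first step. The last angle q_{m+1}
   does not occur in the action and is chosen to make the last step exact. *)
pose P k i := if k is k'.+1 then q (inord k') (false, i) else 0.
pose Q k i := if (k <= m)%N then q (inord k) (true, i)
  else q ord_max (true, i) - psi ord_max (q ord_max) (false, i).
have Pend i : P m.+1 i = 0.
  rewrite /P qF big1 // => j _; rewrite inordK //.
  by rewrite ltn_eqF ?mul0r.
have PS k i : (k <= m.+1)%N -> `|P k i + S k i| <= e / 2.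
  case: k => [_|k]; first by rewrite add0r.
  rewrite ltnS leq_eqVlt => /predU1P[->|km].
    rewrite Pend add0r /S big1 ?normr0 ?ltW // => l _.
    by rewrite leqNgt ltn_ord mul0r.
  pose j := Ordinal km.
  have -> : P k.+1 i = X j i + Y j i.
    rewrite /P qF -(sum_delta j (fun j => X j i + Y j i)).
    by apply: eq_bigr => l _; rewrite inordK // ltnS ltnW.
  have := Hx (inr (true, (j, i))); have := Hx (inr (false, (j, i))).
  rewrite !gj /= expr0 expr1 -/(X j i) -/(Y j i) !ler_norml.
  by move=> /andP[? ?] /andP[? ?]; apply/andP; split; lra.
exists Q, P; split=> // k i w.
have -> : w = q k.
  apply/ffunP => -[b i']; rewrite ffunE /= /Q /P -ltnS ltn_ord inord_val.
  by case: b.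
split.
  have -> : P k.+1 i - P k i - psi k (q k) (true, i) =
      (P k.+1 i + S k.+1 i) - (P k i + S k i).
    have -> : S k i = psi k (q k) (true, i) + S k.+1 i.
      rewrite /S -(sum_delta k (fun k => psi k (q k) (true, i))) -big_split.
      apply: eq_bigr => l _ /=; rewrite -mulrDl -natrD; congr (_%:R * _).
      by rewrite leq_eqVlt eq_sym val_eqE; case: eqP => // ->; rewrite ltnn.
    ring.
  rewrite [e]splitr (le_trans (ler_normB _ _)) // lerD // PS //.
  by rewrite ltnW // ltn_ord.
have kle : (k <= m)%N by rewrite -ltnS.
rewrite /Q kle inord_val.
have [km|km] := ltnP k m; last first.
  have -> : k = ord_max by apply/val_inj/eqP; rewrite eqn_leq km kle.
  by rewrite (_ : _ - _ + _ = 0) ?normr0 ?ltW //; ring.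
pose j := Ordinal km.
have -> : q (inord k.+1) (true, i) - q k (true, i) = X j i - Y j i.
  rewrite !qT opprD addrACA subrr add0r -sumrB.
  rewrite -(sum_delta j (fun j => X j i - Y j i)); apply: eq_bigr => l _.
  rewrite inordK // -mulrBl; congr (_ * _).
  rewrite ltnS leq_eqVlt -[l == j]val_eqE /=.
  by case: ltngtP => //=; rewrite ?subrr ?subr0.
have kE : widen_ord (leqnSn m) j = k by apply/val_inj.
have := Hx (inr (true, (j, i))); have := Hx (inr (false, (j, i))).
rewrite !gj kE /= expr0 expr1 -/(X j i) -/(Y j i) !ler_norml.
by move=> /andP[? ?] /andP[? ?]; apply/andP; split; lra.
Qed.
End DiscreteChord.

(** * Differential calculus *)

Local Open Scope classical_set_scope.

Section Germs.
Variables (R : realType) (V : normedModType R).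
Implicit Types (f g : V -> R) (U : set V).

Lemma near_continuous f g x : (\forall y \near x, f y = g y) ->
  {for x, continuous f} -> {for x, continuous g}.
Proof.
move=> fg fc; rewrite /prop_for /continuous_at -(nbhs_singleton fg).
by apply: cvg_trans fc; apply: near_eq_cvg.
Qed.

Lemma near_is_diff f g x : (\forall y \near x, f y = g y) ->
  differentiable f x -> is_diff x g ('d f x).
Proof.
move=> fg df.
have fg0 : \forall h \near (0 : V), f (h + x) = g (h + x).
  by move: fg; rewrite (near_shift 0) subr0.
have gE : g \o shift x = cst (g x) + 'd f x +o_ 0 id.
  apply/eqaddoP => e e0; have /eqaddoP/(_ _ e0) := diff_locally df.
  apply: filterS2 fg0 => h fgh.
  by rewrite /= !fctE /= fgh (nbhs_singleton fg).
have dfc : continuous ('d f x) by exact: diff_continuous.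
have dE : 'd g x = 'd f x :> (V -> R) by exact: diff_unique.
apply: DiffDef => //; apply/diff_locallyP; rewrite dE; split => //.
Qed.

Lemma near_differentiable f g x : (\forall y \near x, f y = g y) ->
  differentiable f x -> differentiable g x.
Proof. by move=> fg df; have [] := near_is_diff fg df. Qed.

Lemma near_derive f g x v : (\forall y \near x, f y = g y) ->
  differentiable f x -> 'D_v g x = 'D_v f x.
Proof.
move=> fg df; have dg := near_is_diff fg df.
by rewrite !deriveE // diff_val.
Qed.

Lemma eq_Ck_on U k f g : open U -> (forall x, U x -> f x = g x) ->
  Ck_on U k f -> Ck_on U k g.
Proof.
move=> oU; elim: k f g => [|k IH] f g fg /=.
  move=> cf x Ux; apply: near_continuous (cf x Ux).
  by apply: filterS (open_nbhs_nbhs (conj oU Ux)) => y; exact: fg.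
have nfg x : U x -> \forall y \near x, f y = g y.
  by move=> Ux; apply: filterS (open_nbhs_nbhs (conj oU Ux)) => y; exact: fg.
move=> [df cf]; split=> [x Ux|v].
  by apply: near_differentiable (nfg x Ux) (df x Ux).
apply: IH (cf v) => x Ux.
by rewrite -(near_derive v (nfg x Ux)) //; exact: df.
Qed.

(** Induction on [k]: as [W] is open, the directional derivatives of [f] vanish on [W] too. *)
Lemma Ck_on_extend0 U W k f : open U -> open W -> U `|` W = setT ->
  (forall x, W x -> f x = 0) -> Ck_on U k f -> Ck_on setT k f.
Proof.
move=> oU oW UW; elim: k f => [|k IH] f f0 /=.
  move=> cf x _; have : (U `|` W) x by rewrite UW.
  case=> [/cf//|Wx]; apply: (@near_continuous (cst 0));
    last exact: cst_continuous.
  by apply: filterS (open_nbhs_nbhs (conj oW Wx)) => y /f0.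
have nf x : W x -> \forall y \near x, cst 0 y = f y.
  by move=> Wx; apply: filterS (open_nbhs_nbhs (conj oW Wx)) => y /f0.
move=> [df cf]; split=> [x _|v].
  have : (U `|` W) x by rewrite UW.
  case=> [/df//|Wx].
  exact: (near_differentiable (nf x Wx)).
apply: IH (cf v) => x Wx.
by rewrite (near_derive v (nf x Wx)) // derive_cst.
Qed.

Lemma mvt_line f x y : (forall z, differentiable f z) ->
  exists2 t : R, 0 <= t <= 1 & f y - f x = 'D_(y - x) f (x + t *: (y - x)).
Proof.
move=> df; pose c (t : R) := x + t *: (y - x).
have dc (t : R) : is_derive t (1 : R) (f \o c) ('D_(y - x) f (c t)).
  have E : (fun h : R => h^-1 *: (((f \o c) \o shift t) (h *: 1) - (f \o c) t)) =
      (fun h : R => h^-1 *: ((f \o shift (c t)) (h *: (y - x)) - f (c t))).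
    apply/funext => h; rewrite /= /c; congr (_ *: (f _ - _)).
    by rewrite -[h *: 1]/(h * 1) mulr1 scalerDl addrCA.
  by apply: DeriveDef; rewrite /derivable /derive E //; exact: diff_derivable.
have [|t t01 E] := @MVT_segment R (f \o c) (fun t => 'D_(y - x) f (c t)) 0 1
  ler01 (fun t _ => dc t).
  apply: continuous_subspaceT => t.
  apply: differentiable_continuous; apply/derivable1_diffP.
  exact: ex_derive.
exists t; first by move: t01; rewrite in_itv.
have c1 : c 1 = y by rewrite /c scale1r addrC subrK.
have c0 : c 0 = x by rewrite /c scale0r addr0.
by move: E; rewrite /= c1 c0 subr0 mulr1.
Qed.
End Germs.

(** * Coordinates, gradients and Taylor estimates *)

Section Coordinates.
Variables (R : realType) (n : nat).
Local Notation T := (bool * 'I_n)%type.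
Local Notation W := (R * coords R n)%type.

(* [(true, i)] indexes theta_i and [(false, i)] indexes p_i. *)
Definition coordinate (x : coords R n) (t : T) : R :=
  if t.1 then x.1 0 t.2 else x.2 0 t.2.

Definition axis (t : T) : coords R n :=
  if t.1 then (delta_mx 0 t.2, 0) else (0, delta_mx 0 t.2).

Lemma coordinateB x y t : coordinate (x - y) t = coordinate x t - coordinate y t.
Proof. by case: t => -[] i; rewrite /coordinate /= !mxE. Qed.

Lemma mx_norm_le m (v : 'rV[R]_m) r :
  (`|v| <= r) = (0 <= r) && [forall i, `|v 0 i| <= r].
Proof.
rewrite /Num.norm /= mx_normrE; apply/idP/andP => [vr|[r0 /forallP H]].
  split; first by apply: le_trans vr; exact: bigmax_ge_id.
  apply/forallP => i; apply: le_trans vr.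
  exact: (le_bigmax _ (fun ij : 'I_1 * 'I_m => `|v ij.1 ij.2|) (0, i)).
by apply: bigmax_le => // -[i j] _; rewrite [i]ord1 /=; exact: H.
Qed.

Lemma coordinate_norm x t : `|coordinate x t| <= `|x|.
Proof.
rewrite prod_normE le_max /coordinate; case: t => -[] i /=.
  by have := lexx `|x.1|; rewrite {1}mx_norm_le => /andP[_ /forallP/(_ i) ->].
have := lexx `|x.2|; rewrite {1}mx_norm_le => /andP[_ /forallP/(_ i) ->].
by rewrite orbT.
Qed.

Lemma norm_coordinate x r : 0 <= r -> (forall t, `|coordinate x t| <= r) ->
  `|x| <= r.
Proof.
move=> r0 H; rewrite prod_normE ge_max !mx_norm_le r0 /=.
by apply/andP; split; apply/forallP => i; [have := H (true, i)|have := H (false, i)].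
Qed.

Lemma coords_sum_axis (x : coords R n) : x = \sum_t coordinate x t *: axis t.
Proof.
rewrite -(pair_bigA _ (fun b i => coordinate x (b, i) *: axis (b, i))) /=.
rewrite big_bool /=.
have fst_sum (F : 'I_n -> coords R n) : (\sum_i F i).1 = \sum_i (F i).1.
  exact: (big_morph fst).
have snd_sum (F : 'I_n -> coords R n) : (\sum_i F i).2 = \sum_i (F i).2.
  exact: (big_morph snd).
apply: injective_projections; rewrite /= ?fst_sum ?snd_sum /=.
  rewrite [X in _ + X]big1 ?addr0 => [|i _]; last by rewrite scaler0.
  exact: row_sum_delta.
rewrite [X in X + _]big1 ?add0r => [|i _]; last by rewrite scaler0.
exact: row_sum_delta.
Qed.

Definition grad (f : W -> R) (w : W) (t : T) : R := 'D_(0, axis t) f w.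

Lemma derive_coords (f : W -> R) (w : W) (v : coords R n) : differentiable f w ->
  'D_(0, v) f w = \sum_t grad f w t * coordinate v t.
Proof.
move=> df; rewrite deriveE //.
have -> : (0, v) = \sum_t coordinate v t *: ((0, axis t) : W).
  rewrite {1}[v]coords_sum_axis; elim/big_ind2 : _ => [//|a b a' b' <- <-|t _].
    by apply: injective_projections; rewrite /= ?addr0.
  by apply: injective_projections => /=; first exact/esym/mulr0.
rewrite linear_sum; apply: eq_bigr => t _ /=.
by rewrite linearZ /= /grad deriveE // mulrC.
Qed.

Lemma derive_time_coords (f : W -> R) (w v : W) : differentiable f w ->
  'D_v f w = 'D_(1, 0) f w * v.1 + \sum_t grad f w t * coordinate v.2 t.
Proof.
move=> df; rewrite -derive_coords // !deriveE //.
have {1}-> : v = v.1 *: ((1, 0) : W) + (0, v.2).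
  apply: injective_projections => /=; last by rewrite scaler0 add0r.
  by rewrite -[_ *: _]/(_ * _) mulr1 addr0.
by rewrite linearD linearZ /= mulrC.
Qed.

Lemma bounded_derive_lipschitz (f : W -> R) (C : R) :
  (forall w : W, differentiable f w) ->
  (forall w : W, `|'D_(1, 0) f w| <= C) -> (forall w t, `|grad f w t| <= C) ->
  forall w w' : W, `|f w' - f w| <= (1 + #|{: T}|%:R) * C * `|w' - w|.
Proof.
move=> df Ct Cx w w'; have [s _ ->] := mvt_line w w' df.
rewrite derive_time_coords //.
have [n1 n2] : `|(w' - w).1| <= `|w' - w| /\ `|(w' - w).2| <= `|w' - w|.
  by split; rewrite [leRHS]prod_normE le_max lexx ?orbT.
rewrite (le_trans (ler_normD _ _)) // -mulrA mulrDl mul1r lerD //.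
  by rewrite normrM ler_pM.
rewrite -sum_const (le_trans (ler_norm_sum _ _ _)) //; apply: ler_sum => t _.
by rewrite normrM ler_pM // (le_trans (coordinate_norm _ _)).
Qed.

(** By the mean value theorem the error is the change of the gradient paired with y - x. With D the
    sum of squares, each gradient component changes by at most L sqrt D and each coordinate of y - x
    is at most sqrt D; the cardinality counts the components. *)
Lemma lipschitz_grad_taylor (f : W -> R) (L : R) : 0 <= L ->
  (forall w : W, differentiable f w) ->
  (forall (w w' : W) t, `|grad f w' t - grad f w t| <= L * `|w' - w|) ->
  forall s (x y : coords R n),
  f (s, y) <= f (s, x) +
    \sum_t grad f (s, x) t * (coordinate y t - coordinate x t)
    + L * #|{: T}|%:R * \sum_t (coordinate y t - coordinate x t) ^+ 2.
Proof.
move=> L0 df Lf s x y; have [r /andP[r0 r1] E] := mvt_line (s, x) (s, y) df.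
set N := #|_|%:R; pose D := \sum_t (coordinate y t - coordinate x t) ^+ 2.
rewrite -/D -addrA -lerBlDl E.
have -> : (s, y) - (s, x) = (0, y - x) :> W.
  by apply: injective_projections => //=; exact: subrr.
rewrite derive_coords //; set w := _ + _.
rewrite -lerBlDl -sumrB.
have D0 : 0 <= D by apply: sumr_ge0 => t _; exact: sqr_ge0.
have nD t : (coordinate y t - coordinate x t) ^+ 2 <= D.
  by rewrite /D (bigD1 t) //= lerDl; apply: sumr_ge0 => i _; exact: sqr_ge0.
have nyx : `|y - x| <= Num.sqrt D.
  apply: norm_coordinate; first exact: sqrtr_ge0.
  by move=> t; rewrite coordinateB -sqrtr_sqr ler_sqrt.
have nw : `|w - (s, x)| <= Num.sqrt D.
  rewrite /w addrAC subrr add0r normrZ ger0_norm //.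
  rewrite (le_trans (ler_piMl _ r1)) // prod_normE /= normr0 ge_max nyx.
  by rewrite sqrtr_ge0.
rewrite [L * N]mulrC -mulrA -sum_const; apply: ler_sum => t _.
rewrite coordinateB -mulrBl (le_trans (ler_norm _)) // normrM.
rewrite -(sqr_sqrtr D0) expr2 mulrA ler_pM //.
  by rewrite (le_trans (Lf _ _ _)) // ler_wpM2l.
by rewrite -sqrtr_sqr ler_sqrt.
Qed.
End Coordinates.
Arguments axis {R n} t.

(** * Extension of the Hamiltonian by zero *)

Section Compactness.

Lemma mx_coord_continuous (T : topologicalType) m n i j :
  continuous (fun M : 'M[T]_(m, n) => M i j).
Proof.
move=> M A nA; exists (fun i' j' => if (i' == i) && (j' == j) then A else setT).
  move=> i' j'; case: ifP => [/andP[/eqP-> /eqP->]//|_]; exact: filterT.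
by move=> N /(_ i j); rewrite !eqxx.
Qed.

Lemma continuous_bounded (R : realType) (T : topologicalType) (f : T -> R)
    (K : set T) : compact K -> (forall x, K x -> {for x, continuous f}) ->
  exists2 B, 0 <= B & forall x, K x -> `|f x| <= B.
Proof.
move=> cK cf.
have cfK : compact (f @` K).
  apply: continuous_compact => //.
  by apply: continuous_in_subspaceT => x /set_mem; exact: cf.
have [M [Mr HM]] := compact_bounded cfK.
exists (`|M| + 1) => [|x Kx]; first by rewrite addr_ge0.
by apply: HM; [rewrite (le_lt_trans (ler_norm M)) // ltrDl|exists x].
Qed.

Lemma finite_uniform_bound (R : realType) (J : finType) (X : Type)
    (P : X -> Prop) (f : J -> X -> R) :
  (forall j, exists2 B, 0 <= B & forall x, P x -> `|f j x| <= B) ->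
  exists2 B, 0 <= B & forall j x, P x -> `|f j x| <= B.
Proof.
move=> H; have /choice[B HB] : forall j, exists B, 0 <= B /\
    forall x, P x -> `|f j x| <= B.
  by move=> j; have [B B0 HB] := H j; exists B.
exists (\sum_j B j); first by apply: sumr_ge0 => j _; have [] := HB j.
move=> j x Px; rewrite (le_trans ((HB j).2 x Px)) // (bigD1 j) //= lerDl.
by apply: sumr_ge0 => i _; have [] := HB i.
Qed.

(** Both p_i and 1 / (1 + p_i) are continuous, hence bounded on the compact support; the second
    bound keeps p_i away from the end -1. *)
Lemma support_bound (R : realType) n (F : S1 R * M R n -> R) :
  compactly_supported F -> exists2 B, 0 < B &
  forall (s : S1 R) (z : M R n) i, F (s, z) != 0 ->
    -1 + B^-1 <= \val (z.2 0 i) <= B.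
Proof.
move=> cF; pose K := closure [set x | F x != 0].
pose p i (x : S1 R * M R n) : R := \val (x.2.2 0 i).
have p1 i x : 0 < 1 + p i x.
  have := valP (x.2.2 0 i); rewrite inE /ray /= => H.
  by rewrite -ltrBlDl sub0r.
have cp i : continuous (p i).
  move=> x; apply: (@continuous_comp _ _ _
    (fun x : S1 R * M R n => x.2.2 0 i) \val).
    apply: (@continuous_comp _ _ _ (fun x : S1 R * M R n => x.2.2)
      (fun v : 'rV[Ray R]_n => v 0 i)); last exact: mx_coord_continuous.
    apply: (@continuous_comp _ _ _ (fun x : S1 R * M R n => x.2)
      (fun v : M R n => v.2)); exact: cvg_snd.
  exact: initial_continuous.
have [B1 B10 HB1] : exists2 B, 0 <= B & forall i x, K x -> `|p i x| <= B.
  apply: (finite_uniform_bound (P := K)) => i.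
  by apply: continuous_bounded => // x _; exact: cp.
have [B2 B20 HB2] : exists2 B, 0 <= B &
    forall i x, K x -> `|(1 + p i x)^-1| <= B.
  apply: (finite_uniform_bound (P := K)) => i.
  apply: continuous_bounded => // x _.
  apply: continuousV; first by rewrite gt_eqF.
  by apply: continuousD; [exact: cst_continuous|exact: cp].
exists (B1 + B2 + 1); first by rewrite ltr_wpDl // addr_ge0.
move=> s z i Fsz; have Kx : K (s, z) by apply: subset_closure.
have b0 : 0 < B1 + B2 + 1 by rewrite ltr_wpDl // addr_ge0.
have := HB1 i _ Kx; have := HB2 i _ Kx; rewrite /p /=.
set r := \val _; have r1 : 0 < 1 + r := p1 i (s, z).
rewrite gtr0_norm ?invr_gt0 // => H2 H1; apply/andP; split; last first.
  by rewrite (le_trans (ler_norm _)) // (le_trans H1) // -addrA lerDl addr_ge0.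
rewrite -lerBrDl opprK [r + 1]addrC -[leRHS]invrK lef_pV2 ?posrE ?invr_gt0 //.
by rewrite (le_trans H2) // -addrA addrCA lerDl addr_ge0.
Qed.

End Compactness.

Section Angles.
Variable R : realType.

Lemma angleD (x y : R) : angle y = angle 0 -> angle (x + y) = angle x.
Proof.
move=> /(congr1 \val)[]; rewrite cos0 sin0 => cy sy.
by apply/val_inj; rewrite /= cosD sinD cy sy !mulr1 !mulr0 subr0 addr0.
Qed.

Lemma angle_int (k : int) : angle (2 * pi * k%:~R) = angle 0 :> S1 R.
Proof.
have Hn (m : nat) : angle (2 * pi * m%:R) = angle 0 :> S1 R.
  have -> : 2 * pi * m%:R = 0 + pi *+ 2 *+ m :> R.
    by rewrite add0r -(mulr_natl pi) mulr_natr.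
  apply/val_inj => /=.
  by rewrite (periodicn (@cosD2pi R)) (periodicn (@sinD2pi R)).
case: k => m; first exact: Hn.
have := Hn m.+1 => /(congr1 \val)[]; rewrite cos0 sin0 => cy sy.
by apply/val_inj; rewrite /= NegzE rmorphN /= mulrN cosN sinN cy sy oppr0 cos0 sin0.
Qed.

Lemma angle_reduce (x : R) : exists2 y, angle y = angle 0 & 0 <= x + y <= 2 * pi.
Proof.
have pi2 : 0 < 2 * pi :> R by rewrite mulr_gt0 // pi_gt0.
pose k := Num.floor (x / (2 * pi)).
exists (2 * pi * (- k)%:~R); first exact: angle_int.
have kx : k%:~R <= x / (2 * pi) by exact: floor_le_tmp.
have xk : x / (2 * pi) < (k + 1)%:~R by exact: floorD1_gt.
move: kx xk; rewrite ler_pdivlMr // ltr_pdivrMr // intrD rmorphN /=.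
by move=> *; apply/andP; split; lra.
Qed.
End Angles.

Section Extension.
Variables (R : realType) (n : nat).
Local Notation W := (R * coords R n)%type.

(** The deck translations of the universal cover of time and angles. *)
Definition period (v : W) := [/\ time v.1 = time 0, v.2.2 = 0 &
  forall i, angle (v.2.1 0 i) = angle 0].

Definition tame (a b : R) (f : W -> R) :=
  (forall w v : W, period v -> f (w + v) = f w) /\
  (forall (w : W) i, ~~ (a <= w.2.2 0 i <= b) -> f w = 0).

Lemma p_continuous i : continuous (fun w : W => w.2.2 0 i).
Proof.
move=> w; apply: (@continuous_comp _ _ _ (fun w : W => w.2.2)
  (fun v : 'rV[R]_n => v 0 i)); last exact: coord_continuous.
by apply: (@continuous_comp _ _ _ (fun w : W => w.2)
  (fun x : coords R n => x.2)); exact: cvg_snd.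
Qed.

Lemma near_p_lt (a : R) i (w : W) : w.2.2 0 i < a ->
  \forall y \near w, (y : W).2.2 0 i < a.
Proof.
move=> wi; have := @p_continuous i w [set r | r < a]; apply.
exact: lt_nbhsl.
Qed.

Lemma near_p_gt (a : R) i (w : W) : a < w.2.2 0 i ->
  \forall y \near w, a < (y : W).2.2 0 i.
Proof.
move=> wi; have := @p_continuous i w [set r | a < r]; apply.
exact: lt_nbhsr.
Qed.

Lemma tame_derive a b (f : W -> R) v :
  tame a b f -> tame a b (fun w => 'D_v f w).
Proof.
move=> [fper f0]; split=> [w T PT|w i wi].
  rewrite /derive.
  have -> // : (fun h : R => h^-1 *: ((f \o shift (w + T)) (h *: v) - f (w + T))) =
      (fun h : R => h^-1 *: ((f \o shift w) (h *: v) - f w)).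
  by apply/funext => h; rewrite /= addrA !(fper _ T PT).
have H : \forall y \near w, cst 0 y = f y.
  move: wi; rewrite negb_and -!ltNge => /orP[wi|wi].
    apply: filterS (near_p_lt wi) => y yi.
    by rewrite (f0 y i) // negb_and -!ltNge yi.
  apply: filterS (near_p_gt wi) => y yi.
  by rewrite (f0 y i) // negb_and -!ltNge yi orbT.
by rewrite (near_derive v H) ?derive_cst.
Qed.

(** Periods move any point with all p_i in [a, b] into a compact box, [0, 1] in time and [0, 2 pi]
    in each angle; elsewhere [f] vanishes. *)
Lemma tame_bounded a b (f : W -> R) :
  tame a b f -> (forall w : W, {for w, continuous f}) ->
  exists2 B, 0 <= B & forall w : W, `|f w| <= B.
Proof.
move=> [fper f0] cf.
pose K : set W := `[0, 1]%classic `*`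
  ([set v : 'rV[R]_n | forall i, `[0, 2 * pi]%classic (v ord0 i)] `*`
   [set v : 'rV[R]_n | forall i, `[a, b]%classic (v ord0 i)]).
have cK : compact K.
  apply: compact_setX; first exact: segment_compact.
  apply: compact_setX.
    apply: (rV_compact (A := fun=> `[0, 2 * pi]%classic)) => i.
    exact: segment_compact.
  apply: (rV_compact (A := fun=> `[a, b]%classic)) => i.
  exact: segment_compact.
have [B B0 HB] := continuous_bounded cK (fun w _ => cf w).
exists B => // w.
have [/forallP wab|/forallPn[i wi]] := boolP [forall i, a <= w.2.2 0 i <= b];
  last by rewrite (f0 _ i) // normr0.
have /choice[y yP] : forall i, exists y, angle y = angle 0 /\
    0 <= w.2.1 0 i + y <= 2 * pi.
  by move=> i; have [y] := angle_reduce (w.2.1 0 i); exists y.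
pose k := Num.floor w.1.
pose T : W := ((- k)%:~R, (\row_i y i, 0)).
have PT : period T.
  split=> //= [|i]; last by rewrite mxE; have [] := yP i.
  by rewrite /time angle_int mulr0.
rewrite -(fper w T PT); apply: HB; split => /=; last first.
  split=> i /=; last by rewrite addr0 in_itv /=; exact: wab.
  by rewrite in_itv !mxE; have [] := yP i.
rewrite in_itv /= rmorphN /=; apply/andP; split.
  by rewrite subr_ge0 floor_le_tmp.
by rewrite lerBlDl ltW // -[X in _ + X]/(1%:~R) -intrD floorD1_gt.
Qed.

Variable F : S1 R * M R n -> R.
Hypotheses (smooth_F : smooth F) (supp_F : compactly_supported F).

(** Replaces the junk values of [cover] outside [coords_dom] by 0, so that the calculus takes place
    on a whole vector space. *)
Definition extension (w : W) : R :=
  if `[< coords_dom w.2 >] then F (time w.1, cover w.2) else 0.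

Lemma to_rayK (r : R) : -1 < r -> \val (to_ray r) = r.
Proof. by move=> r1; rewrite /to_ray insubdK // inE. Qed.

Lemma open_coords_dom : open [set w : W | coords_dom w.2].
Proof.
rewrite openE => w wU.
have H : \forall y \near w, forall i, -1 < (y : W).2.2 0 i.
  exact: (@filter_forall W 'I_n (fun i (y : W) => is_true (-1 < y.2.2 0 i))
    (nbhs w) _ (fun i => near_p_gt (wU i))).
exact: H.
Qed.

Lemma extension_support : exists a b, -1 < a /\
  forall (w : W) i, ~~ (a <= w.2.2 0 i <= b) -> extension w = 0.
Proof.
have [B B0 HB] := support_bound supp_F.
exists (-1 + B^-1), B; split; first by rewrite ltrDl invr_gt0.
move=> w i wi; rewrite /extension; case: asboolP => // wU.
apply/eqP; apply: contraNT wi => /(HB _ _ i); rewrite mxE to_rayK //; exact: wU.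
Qed.

Lemma extension_tame : exists a b, tame a b extension.
Proof.
have [a [b [_ H]]] := extension_support; exists a, b.
split=> // w v [v1 v22 v21].
rewrite /extension /coords_dom /= v22 addr0.
have -> : time (w.1 + v.1) = time w.1.
  rewrite /time mulrDr angleD //.
  by move: v1; rewrite /time mulr0.
suff -> : cover (w.2 + v.2) = cover w.2 by [].
rewrite /cover /= v22 addr0; congr (_, _); apply/rowP => i; rewrite !mxE.
by rewrite angleD.
Qed.

(** The support stays in p_i >= a with a > -1, so the open sets [coords_dom] and [N], where some p_i
    < a, cover the space, and the extension is zero on [N]. *)
Lemma extension_Ck k : Ck_on setT k extension.
Proof.
have [a [b [a1 H]]] := extension_support.
pose N := [set w : W | exists i, w.2.2 0 i < a].
apply: (@Ck_on_extend0 _ _ [set w : W | coords_dom w.2] N).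
- exact: open_coords_dom.
- rewrite openE => w [i wi]; rewrite /interior /=.
  by apply: filterS (near_p_lt wi) => y yi; exists i.
- apply/seteqP; split => // w _.
  have [wU|/existsNP[i wi]] := pselect (coords_dom w.2); first by left.
  right; exists i; rewrite (le_lt_trans _ a1) // leNgt; exact/negP.
- by move=> w [i wi]; rewrite (H w i) // negb_and -ltNge wi.
apply: eq_Ck_on (smooth_F k); first exact: open_coords_dom.
by move=> w wU; rewrite /extension asboolT.
Qed.

Lemma extension_partial s (x : coords R n) t : coords_dom x ->
  'd (fun y => F (time s, cover y)) x (axis t) = grad extension (s, x) t.
Proof.
move=> xU; pose g (y : coords R n) := extension (s, y).
have dG (w : W) : differentiable extension w.
  by have [H _] := extension_Ck 1; exact: H.
have dg : differentiable g x.
  exact: (@differentiable_comp _ _ _ _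
    (fun y : coords R n => (s, y) : W) extension).
have near_g : \forall y \near x, g y = F (time s, cover y).
  have : \forall y \near x, forall i, -1 < (y : coords R n).2 0 i.
    have cx i : {for x, continuous (fun y : coords R n => y.2 0 i)}.
      apply: (@continuous_comp _ _ _ (fun y : coords R n => y.2)
        (fun v : 'rV[R]_n => v 0 i)); [exact: cvg_snd|exact: coord_continuous].
    exact: (@filter_forall _ 'I_n
      (fun i (y : coords R n) => is_true (-1 < y.2 0 i)) (nbhs x) _
      (fun i => cx i _ (lt_nbhsr (xU i)))).
  by apply: filterS => y yU; rewrite /g /extension asboolT.
have /@diff_val -> := near_is_diff near_g dg.
have -> : 'd g x (axis t) = 'D_(axis t) g x by rewrite deriveE.
rewrite /grad /derive.
have -> // : (fun h : R => h^-1 *: ((g \o shift x) (h *: axis t) - g x)) =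
    (fun h : R => h^-1 *: ((extension \o shift ((s, x) : W)) (h *: (0, axis t)) -
      extension (s, x))).
apply/funext => h; rewrite /g /=; congr (_ *: (extension _ - _)).
by apply: injective_projections => //=; rewrite -[_ *: 0]/(_ * 0) mulr0 add0r.
Qed.
End Extension.

Record regular_extension (R : realType) n (F : S1 R * M R n -> R)
    (G : R * coords R n -> R) (C L : R) : Prop := RegularExtension {
  regular_C0 : 0 <= C;
  regular_L0 : 0 <= L;
  regular_bound : forall w, `|G w| <= C;
  regular_grad_bound : forall w t, `|grad G w t| <= C;
  regular_grad_lip : forall w w' t,
    `|grad G w' t - grad G w t| <= L * `|w' - w|;
  regular_taylor : forall s x y, G (s, y) <= G (s, x) +
    \sum_t grad G (s, x) t * (coordinate y t - coordinate x t)
    + L * \sum_t (coordinate y t - coordinate x t) ^+ 2;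
  regular_period : forall w v t, period v -> grad G (w + v) t = grad G w t;
  regular_partial : forall s (x : coords R n) t, coords_dom x ->
    'd (fun y => F (time s, cover y)) x (axis t) = grad G (s, x) t }.

(** The extension and all its derivatives are tame and continuous, hence bounded; bounds on second
    derivatives make the gradient Lipschitz. *)
Theorem hamiltonian_regularity (R : realType) n (F : S1 R * M R n -> R) :
  smooth F -> compactly_supported F ->
  exists G C L, regular_extension F G C L.
Proof.
move=> sF cF; pose G := extension F.
have [a [b tG]] := extension_tame cF.
have [_ c2] := extension_Ck sF cF 2.
have {c2} [dG c2] : (forall w, differentiable G w) /\ forall v,
    (forall w, differentiable (fun x => 'D_v G x) w) /\
    forall u w, {for w, continuous (fun x => 'D_u (fun y => 'D_v G y) x)}.
  have [d _] := extension_Ck sF cF 1.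
  split=> [w|v]; first exact: d.
  have [d' c'] := c2 v; split=> [w|u w]; first exact: d'.
  exact: c'.
(* [None] is the time direction: the gradient has to be Lipschitz in time as well, for the Euler
   scheme. *)
pose dir (o : option (bool * 'I_n)) : R * coords R n :=
  if o is Some t then (0, axis t) else (1, 0).
have [B0 B00 HB0] : exists2 B, 0 <= B & forall w, `|G w| <= B.
  by apply: (tame_bounded tG) => w; exact: differentiable_continuous.
have [B1 B10 HB1] : exists2 B, 0 <= B & forall t w, True -> `|grad G w t| <= B.
  apply: (finite_uniform_bound (P := fun=> True)) => t.
  have [B B0' HB] := tame_bounded (tame_derive (0, axis t) tG)
    (fun w => differentiable_continuous ((c2 _).1 w)).
  by exists B => // w _; exact: HB.
have [B2 B20 HB2] : exists2 B, 0 <= B & forall to w, True ->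
    `|'D_(dir to.2) (fun x => grad G x to.1) w| <= B.
  apply: (finite_uniform_bound (P := fun=> True)) => to.
  have [B B0' HB] := tame_bounded (tame_derive (dir to.2)
    (tame_derive (0, axis to.1) tG)) ((c2 _).2 (dir to.2)).
  by exists B => // w _; exact: HB.
pose N : R := #|{: bool * 'I_n}|%:R.
(* The Lipschitz constant of the gradient is (1 + N) B2; the last factor absorbs the number of
   coordinates in the Taylor estimate, so that one [L] serves both. *)
pose L := (1 + N) * B2 * (1 + N).
have L1 : 0 <= (1 + N) * B2 by rewrite mulr_ge0 // addr_ge0.
have N1 : 1 <= 1 + N by rewrite lerDl.
have lip w w' t : `|grad G w' t - grad G w t| <= (1 + N) * B2 * `|w' - w|.
  apply: (bounded_derive_lipschitz (f := fun x => grad G x t)) => [z|z|z u].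
  - exact: (c2 _).1.
  - exact: (HB2 (t, None)).
  - exact: (HB2 (t, Some u)).
exists G, (B0 + B1), L; split.
- exact: addr_ge0.
- by rewrite mulr_ge0 // addr_ge0.
- by move=> w; rewrite (le_trans (HB0 w)) // lerDl.
- by move=> w t; rewrite (le_trans (HB1 t w I)) // lerDr.
- move=> w w' t; rewrite (le_trans (lip w w' t)) // ler_wpM2r //.
  by rewrite /L ler_peMr.
- move=> s x y; rewrite (le_trans (lipschitz_grad_taylor L1 dG lip s x y)) //.
  rewrite lerD2l ler_wpM2r //; first by apply: sumr_ge0 => t _; exact: sqr_ge0.
  by rewrite /L ler_wpM2l // lerDr.
- by move=> w v t Pv; have [H _] := tame_derive (0, axis t) tG; exact: H.
- by move=> s x t; exact: extension_partial.
Qed.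

(** * The Euler scheme *)

Lemma sub_telescope (U : zmodType) (x y u w a b : U) :
  x - w = (x - y - a) + (y - u) + (a - b) - (w - u - b).
Proof.
rewrite [x - y - a + _]addrAC [x - y + _]addrA subrK [x - u - a + _]addrA subrK.
by rewrite opprB addrA subrK opprB addrA subrK.
Qed.

Section Euler.
Variables (R : realType) (n : nat).
Variables (V : R -> coords R n -> coords R n) (C L : R).
Hypotheses (C0 : 0 <= C) (L0 : 0 <= L).
Hypothesis V_bound : forall t x, `|V t x| <= C.
Hypothesis V_lip : forall s t x y,
  `|V t y - V s x| <= L * (`|t - s| + `|y - x|).

Lemma coordinate_continuous t : continuous (fun x : coords R n => coordinate x t).
Proof.
case: t => -[] i x.
  apply: (@continuous_comp _ _ _ (fun y : coords R n => y.1)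
    (fun v : 'rV[R]_n => v 0 i)); [exact: cvg_fst|exact: coord_continuous].
apply: (@continuous_comp _ _ _ (fun y : coords R n => y.2)
  (fun v : 'rV[R]_n => v 0 i)); [exact: cvg_snd|exact: coord_continuous].
Qed.

Lemma coordinateZ (a : R) (x : coords R n) t :
  coordinate (a *: x) t = a * coordinate x t.
Proof. by case: t => -[] i; rewrite /coordinate /= !mxE. Qed.

Lemma is_derive_coordinate (c : R -> coords R n) (s : R) v t :
  is_derive s (1 : R) c v ->
  is_derive s (1 : R) (fun s => coordinate (c s) t) (coordinate v t).
Proof.
move=> [dc dv].
have H : (fun h : R => h^-1 *: ((c \o shift s) (h *: 1) - c s)) @ 0^' --> v.
  by rewrite -dv.
have H' : (fun h : R =>
      h^-1 *: (((fun s => coordinate (c s) t) \o shift s) (h *: 1)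
    - coordinate (c s) t)) @ 0^' --> coordinate v t.
  have -> : (fun h : R =>
      h^-1 *: (((fun s => coordinate (c s) t) \o shift s) (h *: 1)
      - coordinate (c s) t)) = (fun x : coords R n => coordinate x t) \o
      (fun h : R => h^-1 *: ((c \o shift s) (h *: 1) - c s)).
    by apply/funext => h; rewrite /= coordinateZ coordinateB.
  exact: (continuous_cvg _ (@coordinate_continuous t v) H).
apply: DeriveDef; first by apply/cvg_ex; exists (coordinate v t).
exact: cvg_lim.
Qed.

Lemma mvt_bound (f df : R -> R) (a h m B : R) : 0 <= h ->
  (forall s, is_derive s (1 : R) f (df s)) ->
  (forall s, a <= s <= a + h -> `|df s - m| <= B) ->
  `|f (a + h) - f a - h * m| <= h * B.
Proof.
move=> h0 fdf H.
have [||s] := @MVT_segment R f df a (a + h) _ (fun s _ => fdf s).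
- by rewrite lerDl.
- apply: continuous_subspaceT => s.
  apply: differentiable_continuous; apply/derivable1_diffP.
  by have [] := fdf s.
rewrite in_itv /= => sah ->.
rewrite addrAC subrr add0r mulrC -mulrBr normrM ger0_norm // ler_wpM2l //.
exact: H.
Qed.

Variable c : R -> coords R n.
Hypothesis cV : forall t, is_derive t (1 : R) c (V t (c t)).

Lemma curve_lip a h : 0 <= h -> `|c (a + h) - c a| <= h * C.
Proof.
move=> h0; apply: norm_coordinate; first exact: mulr_ge0.
move=> t; rewrite coordinateB -[_ - _]subr0 -(mulr0 h).
apply: (mvt_bound (f := fun s => coordinate (c s) t)
  (df := fun s => coordinate (V s (c s)) t)) => // [s|s _].
  exact: is_derive_coordinate.
by rewrite subr0 (le_trans (coordinate_norm _ _)).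
Qed.

(** On [a, a + h] time moves by at most h and the curve by at most h C, so its velocity changes by
    at most L (h + h C). *)
Lemma curve_taylor a h : 0 <= h ->
  `|c (a + h) - c a - h *: V a (c a)| <= h * (L * (h + h * C)).
Proof.
move=> h0; apply: norm_coordinate; first by rewrite !mulr_ge0 // addr_ge0 // mulr_ge0.
move=> t; rewrite !coordinateB coordinateZ.
apply: (mvt_bound (f := fun s => coordinate (c s) t)
  (df := fun s => coordinate (V s (c s)) t)) => // [s|s /andP[as_ sh]].
  exact: is_derive_coordinate.
rewrite -coordinateB (le_trans (coordinate_norm _ _)) // (le_trans (V_lip _ _ _ _)) //.
have sa0 : 0 <= s - a by rewrite subr_ge0.
have sah : s - a <= h by rewrite lerBlDl.
rewrite ler_wpM2l // lerD ?ger0_norm //.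
have := curve_lip a sa0; rewrite [a + _]addrC subrK => /le_trans -> //.
by rewrite ler_wpM2r.
Qed.

(** A discrete Gronwall argument: e_{k+1} <= (1 + h L) e_k + h^2 D, and (1 + h L)^(N+1) <= exp L. In
    D = 2 L (1 + C) + 1, the 1 is the tolerance of the scheme; one L (1 + C) comes from
    [curve_taylor], the other from evaluating the field at (q_k, p_{k+1}) instead of (q_k, p_k). *)
Theorem euler_error N (z : nat -> coords R n) (h := N.+1%:R^-1 : R) :
  (forall k, (k < N.+1)%N ->
    `|z k.+1 - z k - h *: V (k%:R * h) ((z k).1, (z k.+1).2)| <= h ^+ 2) ->
  `|z N.+1 - c 1| <= expR L * (`|z 0%N - c 0| + h * (2 * L * (1 + C) + 1)).
Proof.
move=> zV; pose D := 2 * L * (1 + C) + 1; rewrite -/D.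
have N0 : 0 < N.+1%:R :> R by rewrite ltr0n.
have h0 : 0 <= h by rewrite invr_ge0 ltW.
have h1 : h <= 1 by rewrite invf_le1 // ler1n.
have D0 : 0 <= D by rewrite addr_ge0 // !mulr_ge0 // addr_ge0.
have hL0 : 1 <= 1 + h * L by rewrite lerDl mulr_ge0.
pose e k := `|z k - c (k%:R * h)|.
have step k : (k < N.+1)%N -> e k.+1 <= (1 + h * L) * e k + h ^+ 2 * D.
  move=> kN; pose t := k%:R * h; pose mix : coords R n := ((z k).1, (z k.+1).2).
  have tS : k.+1%:R * h = t + h by rewrite -natr1 mulrDl mul1r.
  have zz : `|z k.+1 - z k| <= h * C + h.
    rewrite -[z k.+1 - z k](subrK (h *: V t mix)) (le_trans (ler_normD _ _)) //.
    rewrite addrC lerD // ?normrZ ?ger0_norm ?ler_wpM2l //.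
    rewrite (le_trans (zV k kN)) // expr2 ler_piMl //.
  have mz : `|mix - z k| <= h * C + h.
    rewrite (le_trans _ zz) // [leRHS]prod_normE prod_normE /= subrr normr0.
    by rewrite ge_max !le_max normr_ge0 lexx orbT.
  have VV : `|V t mix - V t (c t)| <= L * (h * C + h + e k).
    rewrite (le_trans (V_lip _ _ _ _)) // ler_wpM2l // subrr normr0 add0r.
    by rewrite -[mix](subrK (z k)) -addrA (le_trans (ler_normD _ _)) // lerD.
  have -> : e k.+1 = `|(z k.+1 - z k - h *: V t mix) + (z k - c t)
      + h *: (V t mix - V t (c t)) - (c (t + h) - c t - h *: V t (c t))|.
    rewrite /e tS scalerBr; congr (`|_|); exact: sub_telescope.
  rewrite (le_trans (ler_normB _ _)) //.
  rewrite (le_trans (lerD (ler_normD _ _) (lexx _))) //.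
  rewrite (le_trans (lerD (lerD (ler_normD _ _) (lexx _)) (lexx _))) //.
  rewrite normrZ (ger0_norm h0).
  have := zV k kN; have := curve_taylor t h0; rewrite -/t -/mix -/(e k) => T1 T2.
  have T3 : h * `|V t mix - V t (c t)| <= h * (L * (h * C + h + e k)).
    by rewrite ler_wpM2l.
  rewrite (le_trans (lerD (lerD (lerD T2 (lexx _)) T3) T1)) //.
  by rewrite /D le_eqVlt; apply/orP; left; apply/eqP; rewrite /e -/t; ring.
have bound k : (k <= N.+1)%N ->
    e k <= (1 + h * L) ^+ k * (e 0%N + k%:R * (h ^+ 2 * D)).
  elim: k => [|k IH] kN; first by rewrite expr0 mul0r addr0 mul1r.
  rewrite (le_trans (step k kN)) //.
  rewrite (@le_trans _ _ ((1 + h * L) ^+ k.+1 * (e 0%N + k%:R * (h ^+ 2 * D))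
      + h ^+ 2 * D)) //.
    by rewrite lerD2r exprS -mulrA ler_wpM2l ?(le_trans ler01) // IH // ltnW.
  rewrite -[k.+1%:R]natr1 [(k%:R + 1) * _]mulrDl mul1r addrA [leRHS]mulrDr lerD2l.
  by rewrite ler_peMl ?exprn_ege1 // mulr_ge0 // exprn_ge0.
have hN : N.+1%:R * h = 1 by rewrite /h mulfV // gt_eqF.
have := bound N.+1 (leqnn _); rewrite {1}/e hN => /le_trans; apply.
have -> : N.+1%:R * (h ^+ 2 * D) = h * D by rewrite expr2 !mulrA hN mul1r.
rewrite /e mul0r ler_wpM2r //; first by rewrite addr_ge0 // mulr_ge0.
have -> : expR L = expR (h * L) ^+ N.+1 by rewrite -expRM_natl mulrA hN mul1r.
rewrite ler_pXn2r ?nnegrE ?expR_ge0 ?(le_trans ler01) //.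
by rewrite expR_ge1Dx.
Qed.
End Euler.

(** * Chords from the torus to itself *)

Section Chord.
Variables (R : realType) (n : nat) (F : S1 R * M R n -> R).
Variables (G : R * coords R n -> R) (C L : R).
Hypothesis regG : regular_extension F G C L.

(** The convention i_X omega = dF with omega = \sum dp_i /\ dtheta_i gives theta' = - dF/dp and p' =
    dF/dtheta: Hamilton's equations for H = - F. Hence [G] enters the discrete action with a plus
    sign. *)
Definition ham_field (t : R) (x : coords R n) : coords R n :=
  (\row_i - grad G (t, x) (false, i), \row_i grad G (t, x) (true, i)).

Lemma ham_field_coordinate t x k : coordinate (ham_field t x) k =
  if k.1 then - grad G (t, x) (false, k.2) else grad G (t, x) (true, k.2).
Proof. by case: k => -[] i; rewrite /coordinate /= mxE. Qed.

Lemma ham_field_bound t x : `|ham_field t x| <= C.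
Proof.
apply: norm_coordinate; first exact: regular_C0 regG.
move=> k; rewrite ham_field_coordinate.
by case: ifP => _; rewrite ?normrN; exact: regular_grad_bound regG _ _.
Qed.

Lemma ham_field_lip s t x y :
  `|ham_field t y - ham_field s x| <= L * (`|t - s| + `|y - x|).
Proof.
have L0 := regular_L0 regG.
have nle : `|((t, y) : R * coords R n) - (s, x)| <= `|t - s| + `|y - x|.
  by rewrite prod_normE ge_max /= lerDl lerDr !normr_ge0.
have H k : `|grad G (t, y) k - grad G (s, x) k| <= L * (`|t - s| + `|y - x|).
  by rewrite (le_trans (regular_grad_lip regG _ _ _)) // ler_wpM2l.
apply: norm_coordinate => [|k]; first by rewrite mulr_ge0 // addr_ge0.
rewrite coordinateB !ham_field_coordinate.
by case: ifP => _ //; rewrite -opprD normrN.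
Qed.

Lemma ham_field_shift t x (y : 'rV[R]_n) :
  (forall i, angle (y 0 i) = angle 0) -> ham_field t (x + (y, 0)) = ham_field t x.
Proof.
move=> Py; have P : period ((0, (y, 0)) : R * coords R n) by split.
have gE k : grad G (t, x + (y, 0)) k = grad G (t, x) k.
  have -> : (t, x + (y, 0)) = (t, x) + (0, (y, 0)) :> R * coords R n.
    by apply: injective_projections => //=; rewrite addr0.
  exact: regular_period regG _ _ _ P.
by congr (_, _); apply/rowP => i; rewrite !mxE gE.
Qed.

Lemma ham_fieldP X s (x : coords R n) :
  is_hamiltonian_field F X -> coords_dom x -> X (time s) (cover x) = ham_field s x.
Proof.
move=> HX xU.
have H k : omega_std (X (time s) (cover x)) (axis k) = grad G (s, x) k.
  by rewrite HX // (regular_partial regG).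
set v := X _ _ in H *.
have o1 i : omega_std v (axis (true, i)) = v.2 0 i.
  rewrite /omega_std /axis /= (bigD1 i) //= big1 ?addr0.
    by rewrite !mxE !eqxx mulr1 mulr0 subr0.
  by move=> j /negbTE ji; rewrite !mxE ji andbF !mulr0 subr0.
have o2 i : omega_std v (axis (false, i)) = - v.1 0 i.
  rewrite /omega_std /axis /= (bigD1 i) //= big1 ?addr0.
    by rewrite !mxE !eqxx mulr1 mulr0 sub0r.
  by move=> j /negbTE ji; rewrite !mxE ji andbF !mulr0 subr0.
apply: injective_projections; apply/rowP => i; rewrite mxE -H.
  by rewrite o2 opprK.
by rewrite o1.
Qed.

Lemma angle_sub (a b : R) : angle a = angle b -> angle (a - b) = angle 0.
Proof.
move=> /(congr1 \val)[ca sa]; apply/val_inj; rewrite /= cosB sinB ca sa.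
by rewrite -!expr2 cos2Dsin2 mulrC subrr cos0 sin0.
Qed.

Lemma angle_opp (a : R) : angle a = angle 0 -> angle (- a) = angle 0.
Proof. by move=> /esym/angle_sub; rewrite sub0r. Qed.

Lemma cover_shift (x : coords R n) (y : 'rV[R]_n) :
  (forall i, angle (y 0 i) = angle 0) -> cover (x + (y, 0)) = cover x.
Proof.
move=> Py; rewrite /cover /= addr0; congr (_, _).
by apply/rowP => i; rewrite !mxE angleD.
Qed.

(** A lift of the orbit may start at another preimage of the same point. It has p = 0 there and
    angles differing from [q] by periods; translating it back keeps it an integral curve, because
    the field is periodic. *)
Lemma flow_lift X Phi (q : 'rV[R]_n) :
  is_hamiltonian_field F X -> is_flow X Phi ->
  exists c : R -> coords R n, [/\ c 0 = (q, 0),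
    forall t, is_derive t (1 : R) c (ham_field t (c t)),
    forall t, coords_dom (c t) & forall t, Phi t (cover (q, 0)) = cover (c t)].
Proof.
move=> HX HPhi; have [Phi0 [c Hc]] := HPhi (cover (q, 0)).
have [dom0 E0 _] := Hc 0; rewrite Phi0 in E0.
have p0 : (c 0).2 = 0.
  apply/rowP => i; have := congr1 (fun z : M R n => \val (z.2 0 i)) E0.
  by rewrite !mxE !to_rayK // ?oppr_lt0 ?ltr01 //; exact: dom0.
have a0 i : angle (((c 0).1 - q) 0 i) = angle 0.
  rewrite !mxE; apply: angle_sub.
  by have := congr1 (fun z : M R n => z.1 0 i) E0; rewrite !mxE.
have ad i : angle ((- ((c 0).1 - q)) 0 i) = angle 0.
  by have := angle_opp (a0 i); rewrite !mxE.
pose d : coords R n := (- ((c 0).1 - q), 0).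
exists (fun t => c t + d); split=> [|t|t|t].
- apply: injective_projections; rewrite /= ?p0 ?addr0 //.
  by rewrite opprB addrC subrK.
- have [domt Et dct] := Hc t.
  rewrite ham_field_shift // -(ham_fieldP _ HX domt) -Et -[X _ _]addr0.
  by apply: is_deriveD.
- by have [domt _ _] := Hc t; move=> i; rewrite /= addr0; exact: domt.
- by have [_ Et _] := Hc t; rewrite cover_shift.
Qed.

Lemma euler_chord m (h := m.+1%:R^-1 : R) : exists z : nat -> coords R n,
  [/\ forall i, 0 <= (z 0%N).1 0 i <= 2 * pi, (z 0%N).2 = 0, (z m.+1).2 = 0 &
    forall k, (k < m.+1)%N ->
    `|z k.+1 - z k - h *: ham_field (k%:R * h) ((z k).1, (z k.+1).2)| <= h ^+ 2].
Proof.
have h0 : 0 < h by rewrite invr_gt0 ltr0n.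
have h1 : h <= 1 by rewrite invf_le1 ?ler1n // ltr0n.
have C0 := regular_C0 regG; have L0 := regular_L0 regG.
pose Z := {ffun bool * 'I_n -> R}.
pose toc (z : Z) : coords R n := (\row_i z (true, i), \row_i z (false, i)).
have tocK z k : coordinate (toc z) k = z k.
  by case: k => -[] i; rewrite /coordinate /= mxE.
pose phi (k : 'I_m.+1) (z : Z) := h * G (k%:R * h, toc z).
pose psi (k : 'I_m.+1) (z : Z) : Z := [ffun t => h * grad G (k%:R * h, toc z) t].
have hle (a b : R) : `|a| <= b -> `|h * a| <= b.
  move=> ab; rewrite normrM gtr0_norm // (le_trans _ ab) // ler_piMl //.
have phi_bound k z : `|phi k z| <= C by apply/hle/(regular_bound regG).
have psi_bound k z t : `|psi k z t| <= C.
  by rewrite ffunE; apply/hle/(regular_grad_bound regG).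
have psi_lip k : sup_lipschitz L (psi k).
  move=> z w r zw t; rewrite !ffunE -mulrBr; apply: hle.
  rewrite (le_trans (regular_grad_lip regG _ _ _)) // ler_wpM2l //.
  have r0 : 0 <= r := le_trans (normr_ge0 _) (zw t).
  rewrite prod_normE /= subrr normr0 ge_max r0 /=.
  by apply: norm_coordinate => // t'; rewrite coordinateB !tocK.
have taylor k (z w : Z) : phi k w <= phi k z + \sum_t psi k z t * (w t - z t)
    + L * \sum_t (w t - z t) ^+ 2.
  have := regular_taylor regG (k%:R * h) (toc z) (toc w).
  under eq_bigr => t _ do rewrite !tocK.
  under [X in L * X]eq_bigr => t _ do rewrite !tocK.
  set S := \sum_t (w t - z t) ^+ 2.
  have S0 : 0 <= S by apply: sumr_ge0 => t _; exact: sqr_ge0.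
  move=> /(ler_wpM2l (ltW h0)); rewrite !mulrDr => /le_trans; apply.
  rewrite lerD //; last by rewrite ler_piMl // mulr_ge0.
  by rewrite lerD2l mulr_sumr; apply: ler_sum => t _; rewrite ffunE mulrA.
(* The tolerance h^2 matches the local error of the Euler scheme, as [euler_error] requires. *)
have [Q [P [P0 PN QP]]] :=
  discrete_chord C0 L0 phi_bound psi_bound psi_lip taylor (exprn_gt0 2 h0).
(* Translation by periods brings the initial angles into a compact cube that is the same for all
   [m]. *)
have /choice[y yP] : forall i, exists y,
    angle y = angle 0 /\ 0 <= Q 0%N i + y <= 2 * pi.
  by move=> i; have [y] := angle_reduce (Q 0%N i); exists y.
pose s : 'rV[R]_n := \row_i y i.
pose z0 k : coords R n := (\row_i Q k i, \row_i P k i).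
exists (fun k => z0 k + (s, 0)); split => [i|||k km].
- by rewrite !mxE; have [] := yP i.
- by apply/rowP => i; rewrite !mxE P0 addr0.
- by apply/rowP => i; rewrite !mxE PN addr0.
have -> : ((z0 k + (s, 0)).1, (z0 k.+1 + (s, 0)).2) =
    ((z0 k).1, (z0 k.+1).2) + (s, 0) :> coords R n by [].
rewrite ham_field_shift; last by move=> i; rewrite mxE; have [] := yP i.
rewrite opprD addrACA subrr addr0.
apply: norm_coordinate; first exact: sqr_ge0.
move=> t; rewrite !coordinateB coordinateZ ham_field_coordinate.
have [/=] := QP (Ordinal km) t.2.
set w := [ffun _ => _].
have -> : ((z0 k).1, (z0 k.+1).2) = toc w.
  by congr (_, _); apply/rowP => i; rewrite !mxE ffunE.
rewrite !ffunE /= => HP HQ.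
case: t => -[] i in HP HQ *; rewrite /coordinate /= !mxE //.
by rewrite mulrN opprK.
Qed.

Theorem hamiltonian_chord X Phi : is_hamiltonian_field F X -> is_flow X Phi ->
  exists2 x, torus R n x & torus R n (Phi 1 x).
Proof.
move=> HX HPhi.
have /choice[z zP] := euler_chord.
pose u m : 'rV[R]_n := (z m 0%N).1.
pose K : set 'rV[R]_n := [set v | forall i, `[0, 2 * pi]%classic (v ord0 i)].
have cK : compact K.
  apply: (rV_compact (A := fun=> `[0, 2 * pi]%classic)) => i.
  exact: segment_compact.
(* A cluster point [q] of the initial angles is the starting point of the true chord. *)
have [|q [_ clq]] := cK (u @ \oo) _.
  by exists 0%N => // m _ i /=; rewrite in_itv /=; have [H _ _ _] := zP m.
have [c [c0 dc cdom cPhi]] := flow_lift q HX HPhi.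
have c1 i : (c 1).2 0 i = 0.
  apply/eqP; rewrite -normr_eq0 eq_le normr_ge0 andbT.
  apply/ler_addgt0Pl => e e0; rewrite addr0.
  pose D := 2 * L * (1 + C) + 1.
  have D0 : 0 < D.
    rewrite ltr_wpDl // !mulr_ge0 ?addr_ge0 //; first exact: regular_L0 regG.
    exact: regular_C0 regG.
  have E0 := expR_gt0 L.
  (* The error of the endpoint is at most exp L times the initial error plus D / (m + 1); each of
     these two is made at most [r], for some large [m] with [u m] close to [q]. Since the Euler
     trajectory ends at p = 0, this bounds p(1) by [e]. *)
  pose r := e / (2 * expR L).
  have r0 : 0 < r by rewrite divr_gt0 // mulr_gt0.
  pose N := Num.truncn (D / r).
  have [_ [[m /= Nm <-] um]] : (u @` [set m | (N <= m)%N]) `&` ball q r !=set0.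
    apply: clq; last exact: nbhsx_ballx.
    by exists N => // m Nm; exists m.
  have [_ z0 zN Ez] := zP m.
  have := euler_error (regular_C0 regG) (regular_L0 regG) ham_field_bound
    (fun s t x y => ham_field_lip s t x y) dc Ez.
  rewrite -/D => H.
  have n0 : `|z m 0%N - c 0| <= r.
    apply: norm_coordinate; first exact: ltW.
    move=> t; rewrite c0; case: t => -[] j; rewrite /coordinate /= !mxE ?z0 ?mxE.
      rewrite distrC; have := um; rewrite mx_norm_ball /ball_ /= => /ltW.
      by rewrite mx_norm_le => /andP[_ /forallP/(_ j)]; rewrite !mxE.
    by rewrite subrr normr0 ltW.
  have hD : m.+1%:R^-1 * D <= r.
    rewrite mulrC ler_pdivrMr ?ltr0n // -ler_pdivrMl // mulrC.
    rewrite (le_trans (ltW (truncnS_gt _))) // ler_nat //.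
  have -> : `|(c 1).2 0 i| = `|coordinate (z m m.+1 - c 1) (false, i)|.
    by rewrite coordinateB /coordinate /= zN mxE sub0r normrN.
  rewrite (le_trans (coordinate_norm _ _)) // (le_trans H) //.
  have -> : e = expR L * (r + r) by rewrite /r; field; rewrite gt_eqF.
  by rewrite ler_wpM2l ?lerD ?expR_ge0.
exists (cover (q, 0)).
  by move=> i /=; rewrite mxE to_rayK mxE ?oppr_lt0 ?ltr01.
rewrite cPhi => i /=; rewrite mxE to_rayK ?c1 //.
Qed.
End Chord.

Theorem corollaryB (R : realType) (n : nat) (phi : M R n -> M R n) :
  Ham_c R n phi -> (phi @` torus R n) `&` torus R n !=set0.
Proof.
move=> [F [X [Phi [smF cF HX HPhi ->]]]].
have [G [C [L regG]]] := hamiltonian_regularity smF cF.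
have [x xT PhiT] := hamiltonian_chord regG HX HPhi.
by exists (Phi 1 x); split => //; exists x.
Qed.
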